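(* Let $\mathcal{F}=(C_1,\ldots,C_n)$, $n\ge 4$, be an ordered family of pairwise disjoint compact convex sets in $\mathbb{R}^2$. For each $i$ let $f_{C_i}:\mathcal{C}(\mathbb{R}^2)\to\mathbb{R}$ be a monotone function, continuous with respect to the Hausdorff metric, and let $\alpha_{C_i}>0$. Suppose that for any four indices $i_1<i_2<i_3<i_4$ there is a directed line which is an $(f,\alpha)$-transversal of $C_{i_1},\ldots,C_{i_4}$ and meets them in the order $C_{i_1},\ldots,C_{i_4}$. Then there is a directed line which is an $(f,\alpha)$-transversal of all of $C_1,\ldots,C_n$ and meets them in the order $C_1,\ldots,C_n$.
   Context: $\mathcal{C}(\mathbb{R}^2)$ denotes the family of convex subsets of $\mathbb{R}^2$; $g$ is monotone if $K_1\subset K_2$ implies $g(K_1)\le g(K_2)$ (or always $g(K_1)\ge g(K_2)$). For a directed line $\ell$ and convex $C$, $\ell^+(C)$ (resp. $\ell^-(C)$) is the intersection of $C$ with the closed half-plane bounded by $\ell$ to the left (resp. right) of the direction of $\ell$. $\ell$ is an $(f,\alpha)$-stabber of $C_i$ if $f_{C_i}(\ell^+(C_i))\ge\alpha_{C_i}$ and $f_{C_i}(\ell^-(C_i))\ge\alpha_{C_i}$, and an $(f,\alpha)$-transversal of a subfamily if it is an $(f,\alpha)$-stabber of each of its members. A directed line meets $K_1,\ldots,K_m$ in the order $K_1,\ldots,K_m$ if there are points $p_j\in\ell\cap K_j$ appearing along $\ell$ in the order $p_1,\ldots,p_m$ with respect to the direction of $\ell$. *)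

(* Defs.v *)
From HB Require Import structures.
From mathcomp Require Import all_boot all_order all_algebra.
From mathcomp Require Import all_classical all_reals all_analysis.

Set Implicit Arguments.
Unset Strict Implicit.
Unset Printing Implicit Defensive.

Import Order.TTheory GRing.Theory Num.Theory.
Import numFieldNormedType.Exports.

Local Open Scope classical_set_scope.
Local Open Scope ring_scope.

Section Plane.
Context {R : realType}.
Implicit Types (x u v : 'rV[R]_2) (A B C K : set 'rV[R]_2).
Implicit Types (g : set 'rV[R]_2 -> R).

(* The library norm on matrices is the sup norm. *)
Definition euclid_norm x : R := Num.sqrt (x 0 0 ^+ 2 + x 0 1 ^+ 2).

Definition cross u v : R := u 0 0 * v 0 1 - u 0 1 * v 0 0.

(* The Hausdorff distance on arbitrary sets takes the value +oo, e.g. between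
   set0 and a nonempty set. The outer max only matters for A = B = set0, where
   both suprema are -oo. *)
Definition hausdorff_dist A B : \bar R :=
  maxe 0%E
    (maxe
      (ereal_sup [set ereal_inf [set (euclid_norm (x - y))%:E | y in B]
                 | x in A])
      (ereal_sup [set ereal_inf [set (euclid_norm (x - y))%:E | x in A]
                 | y in B])).

(* Functions on the family of convex sets are represented by functions on all
   sets, whose values at non-convex sets are left unconstrained. *)
Definition convex_monotone g : Prop :=
  (forall K1 K2, convex_set K1 -> convex_set K2 -> K1 `<=` K2 -> g K1 <= g K2)
  \/
  (forall K1 K2, convex_set K1 -> convex_set K2 -> K1 `<=` K2 -> g K2 <= g K1).

Definition hausdorff_continuous g : Prop :=
  forall K, convex_set K -> forall e : R, 0 < e ->
  exists2 d : R, 0 < d &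
    forall K', convex_set K' -> (hausdorff_dist K K' < d%:E)%E ->
      `|g K - g K'| < e.

End Plane.

Record directed_line (R : realType) := DirectedLine {
  dl_base : 'rV[R]_2;
  dl_dir : 'rV[R]_2;
  dl_dir_neq0 : dl_dir != 0 }.

Section Transversals.
Context {R : realType}.
Implicit Types (l : directed_line R) (C : set 'rV[R]_2).

Definition dl_point l (t : R) : 'rV[R]_2 := dl_base l + t *: dl_dir l.

Definition left_part l C : set 'rV[R]_2 :=
  C `&` [set x | 0 <= cross (dl_dir l) (x - dl_base l)].

Definition right_part l C : set 'rV[R]_2 :=
  C `&` [set x | cross (dl_dir l) (x - dl_base l) <= 0].

Definition fa_stabber (f : set 'rV[R]_2 -> R) (alpha : R) C l : Prop :=
  alpha <= f (left_part l C) /\ alpha <= f (right_part l C).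

Definition fa_transversal (m : nat) (f : 'I_m -> set 'rV[R]_2 -> R)
    (alpha : 'I_m -> R) (K : 'I_m -> set 'rV[R]_2) l : Prop :=
  forall j, fa_stabber (f j) (alpha j) (K j) l.

(* The witnesses are the points dl_point l (t j). *)
Definition meets_in_order (m : nat) (K : 'I_m -> set 'rV[R]_2) l : Prop :=
  exists t : 'I_m -> R,
    (forall j, K j (dl_point l (t j))) /\
    (forall j k : 'I_m, (j < k)%N -> t j < t k).

End Transversals.

(* Main.v *)
(** For a direction [u], the lines directed by [u] that stab [C_i] form an
interval of parallel lines, and a stabber can be rotated about any point outside
of [C_i] until it leaves too little on one side.

Directions of lines meeting [C_i] before [C_j] form an arc [D_ij] shorter than a
half turn.  If every four indices admit a direction common to their arcs, so do
all of them: by induction pick [k_a] common to all arcs not involving [a]; any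
three of five such directions lie in one arc, so the five are linearly ordered,
each [D_ij] contains at least three of them, and hence it contains the median.
Let [K] be the (closed) intersection of all the arcs.

Suppose that no direction [u] in [K] has a common stabber.  Then either

- for some [p < q] all the ordered stabbers of the pair turn strictly right of
  [u], or
- for some [p < q] they all turn strictly left of [u], or
- some [C_i] has no stabber directed by [u], while for each [k] the pair [i, k]
  has stabbers on both sides of [u].

Rotation makes all three conditions open, and the four-set hypothesis makes them
exclusive.  The first and the third fail at one end of [K] and the second at the
other, which contradicts the connectedness of [K].

Closedness of the set of stabbers, used throughout, fails only for a decreasing
[f_i] and a degenerate [C_i], contained in the candidate line.  One then works
with the closure, and if the line found is not a true stabber of some [C_p], it
is rotated slightly about a point of [C_p]; the sense of rotation is the same
for all the other sets, because any two of them have a stabber in common with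
[C_p]. *)
Require Import Defs.
From mathcomp Require Import all_boot all_order all_algebra.
From mathcomp Require Import all_classical all_reals all_analysis.
From mathcomp Require Import zify ring lra.

Import Order.TTheory GRing.Theory Num.Theory.
Import numFieldNormedType.Exports.

Set Implicit Arguments.
Unset Strict Implicit.
Unset Printing Implicit Defensive.

Local Open Scope classical_set_scope.
Local Open Scope ring_scope.

(** * Planar directions *)

Section PlaneGeometry.
Context {R : realType}.
Implicit Types (u v w x y z : 'rV[R]_2) (D : set 'rV[R]_2).

Lemma rV2P u v : u 0 0 = v 0 0 -> u 0 1 = v 0 1 -> u = v.
Proof.
move=> uv0 uv1; apply/rowP => i.
by have [->|->] : i = 0 \/ i = 1
  by case: i => -[|[|//]] ?; [left|right]; apply/val_inj.
Qed.

Lemma crossDl u v w : cross (u + v) w = cross u w + cross v w.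
Proof. by rewrite /cross !mxE; ring. Qed.

Lemma crossDr u v w : cross u (v + w) = cross u v + cross u w.
Proof. by rewrite /cross !mxE; ring. Qed.

Lemma crossNl u v : cross (- u) v = - cross u v.
Proof. by rewrite /cross !mxE; ring. Qed.

Lemma crossNr u v : cross u (- v) = - cross u v.
Proof. by rewrite /cross !mxE; ring. Qed.

Lemma crossBr u v w : cross u (v - w) = cross u v - cross u w.
Proof. by rewrite crossDr crossNr. Qed.

Lemma crossZl a u v : cross (a *: u) v = a * cross u v.
Proof. by rewrite /cross !mxE; ring. Qed.

Lemma crossZr a u v : cross u (a *: v) = a * cross u v.
Proof. by rewrite /cross !mxE; ring. Qed.

Lemma crossC u v : cross u v = - cross v u.
Proof. by rewrite /cross; ring. Qed.

Lemma crossvv u : cross u u = 0.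
Proof. by rewrite /cross; ring. Qed.

Lemma cross0l u : cross 0 u = 0.
Proof. by rewrite /cross !mxE; ring. Qed.

Lemma cross0r u : cross u 0 = 0.
Proof. by rewrite crossC cross0l oppr0. Qed.

Definition crossE := (crossDl, crossDr, crossNl, crossNr, crossZl, crossZr,
  crossvv, cross0l, cross0r).

Lemma cross_endpoints x y : cross (y - x) y = cross (y - x) x.
Proof. by rewrite /cross !mxE; ring. Qed.

Lemma cross_triple u v w :
  cross v w *: u + cross w u *: v + cross u v *: w = 0.
Proof. by apply: rV2P; rewrite /cross !mxE; ring. Qed.

Lemma cross_plucker h w u v :
  cross h w * cross u v = cross h u * cross w v - cross h v * cross w u.
Proof. by rewrite /cross; ring. Qed.

Definition rot90 u : 'rV[R]_2 := \row_j (if j == 0 then - u 0 1 else u 0 0).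

Lemma cross_rot90 u v : cross u (rot90 v) = u 0 0 * v 0 0 + u 0 1 * v 0 1.
Proof. by rewrite /cross !mxE /=; ring. Qed.

Lemma cross_rot90_gt0 u : u != 0 -> 0 < cross u (rot90 u).
Proof.
move=> u0; rewrite cross_rot90 -!expr2 lt_neqAle addr_ge0 ?sqr_ge0 // andbT.
rewrite eq_sym paddr_eq0 ?sqr_ge0 // !sqrf_eq0; apply: contra u0.
by move=> /andP[/eqP u00 /eqP u01]; apply/eqP/rV2P; rewrite mxE.
Qed.

Lemma cross_eq0P u v : u != 0 -> cross u v = 0 -> exists k, v = k *: u.
Proof.
move=> u0 uv0; have q0 := lt0r_neq0 (cross_rot90_gt0 u0).
exists (cross v (rot90 u) / cross u (rot90 u)).
apply: (scalerI q0); rewrite scalerA mulrCA divff // mulr1.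
have /eqP := cross_triple u v (rot90 u).
by rewrite uv0 scale0r addr0 addr_eq0 (crossC (rot90 u)) scaleNr opprK => /eqP.
Qed.

Lemma cross_eq1 u : u != 0 -> exists w, cross u w = 1.
Proof.
move=> /cross_rot90_gt0/lt0r_neq0 q0.
by exists ((cross u (rot90 u))^-1 *: rot90 u); rewrite crossZr mulVf.
Qed.

Lemma cross_inj u v x y : cross u v != 0 -> cross u x = cross u y ->
  cross v x = cross v y -> x = y.
Proof.
move=> uv ux vx; apply/eqP; rewrite -subr_eq0.
have v0 : v != 0 by apply: contraNneq uv => ->; rewrite cross0r.
have [|k kE] := @cross_eq0P v (x - y) v0; first by rewrite crossBr vx subrr.
have /eqP : cross u (x - y) = 0 by rewrite crossBr ux subrr.
by rewrite kE crossZr mulf_eq0 (negbTE uv) orbF => /eqP ->; rewrite scale0r.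
Qed.

(* Models an arc of directions shorter than a half turn. *)
Definition pointed_cone D :=
  ~ D 0 /\ forall u v a b, D u -> D v -> 0 <= a -> 0 <= b -> 0 < a + b ->
    D (a *: u + b *: v).

Lemma pointed_cone_neq0 D u : pointed_cone D -> D u -> u != 0.
Proof. by move=> [D0 _] Du; apply/eqP => u0; apply: D0; rewrite -u0. Qed.

Lemma pointed_coneZ D u a : pointed_cone D -> D u -> 0 < a -> D (a *: u).
Proof.
move=> [_ cD] Du a0; have := cD u u a 0 Du Du (ltW a0) (lexx _).
by rewrite scale0r !addr0; apply.
Qed.

Lemma pointed_cone_scale_gt0 D u k : pointed_cone D -> D u -> D (k *: u) ->
  0 < k.
Proof.
move=> [D0 cD] Du Dku; rewrite ltNge; apply/negP => k0; apply: D0.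
have := cD u (k *: u) (- k) 1 Du Dku; rewrite scale1r scaleNr addNr.
by apply; lra.
Qed.

Lemma pointed_cone_collinear D u v : pointed_cone D -> D u -> D v ->
  cross u v = 0 -> exists2 k, 0 < k & v = k *: u.
Proof.
move=> pD Du Dv uv0; have [k kE] := cross_eq0P (pointed_cone_neq0 pD Du) uv0.
by exists k => //; apply: (pointed_cone_scale_gt0 pD Du); rewrite -kE.
Qed.

Lemma pointed_cone_cross_trans D u v w : pointed_cone D ->
  D u -> D v -> D w -> 0 <= cross u v -> 0 <= cross v w -> 0 <= cross u w.
Proof.
move=> pD Du Dv Dw uv vw; rewrite leNgt; apply/negP => uw.
have wu : 0 < cross w u by rewrite crossC oppr_gt0.
apply: pD.1; rewrite -(cross_triple u v w) -[X in X + _]scale1r.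
by apply: pD.2 => //; [apply: pD.2 => //; [exact: ltW|lra]|lra].
Qed.

Lemma pointed_cone_between D D' u v w : pointed_cone D -> D u -> D v -> D w ->
  0 <= cross u v -> 0 <= cross v w -> pointed_cone D' -> D' u -> D' w -> D' v.
Proof.
move=> pD Du Dv Dw uv vw pD' Du' Dw'.
have uw := pointed_cone_cross_trans pD Du Dv Dw uv vw.
have [uw0|uw_neq0] := eqVneq (cross u w) 0.
  have [k k0 wE] := pointed_cone_collinear pD Du Dw uw0.
  have uv0 : cross u v = 0.
    by apply/eqP; move: vw; rewrite eq_le uv wE crossZr crossC; nra.
  have [l l0 ->] := pointed_cone_collinear pD Du Dv uv0.
  exact: pointed_coneZ.
have vE : cross u w *: v = cross v w *: u + cross u v *: w.
  have /eqP := cross_triple u v w; rewrite addrAC (crossC w u) scaleNr.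
  by rewrite subr_eq0 => /eqP.
rewrite -[v](scalerK uw_neq0) vE.
apply: pointed_coneZ => //; last by rewrite invr_gt0 lt_neqAle eq_sym uw_neq0.
apply: pD'.2 => //; rewrite lt_neqAle addr_ge0 // andbT eq_sym paddr_eq0 //.
apply: contra (pointed_cone_neq0 pD Dv) => /andP[/eqP vw0 /eqP uv0].
by have /eqP := vE; rewrite vw0 uv0 !scale0r addr0 scaler_eq0 (negbTE uw_neq0).
Qed.

(* Angle orders the vectors of [s] linearly, and their median has two of them
   on either side, so that a cone missing at most two vectors surrounds it. *)
Lemma pointed_cone_median (T : eqType) (f : T -> 'rV[R]_2) (s : seq T) :
  uniq s -> size s = 5 ->
  (forall a b c, a \in s -> b \in s -> c \in s ->
    exists D, [/\ pointed_cone D, D (f a), D (f b) & D (f c)]) ->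
  exists2 m, m \in s & forall D i j, pointed_cone D ->
    (forall a, a \in s -> a != i -> a != j -> D (f a)) -> D (f m).
Proof.
move=> us s5 common; pose r a b := 0 <= cross (f a) (f b).
have r_total : {in s &, total r}.
  by move=> a b _ _; rewrite /r (crossC (f b)) oppr_ge0; exact: le_total.
have r_trans : {in s & &, transitive r}.
  move=> b a c bs as_ cs; have [D [pD Da Db Dc]] := common a b c as_ bs cs.
  exact: pointed_cone_cross_trans pD Da Db Dc.
have /= sort_size := size_sort r s; rewrite s5 in sort_size.
have := sort_sorted_in r_total (allss s); have := sort_uniq r s; rewrite us.
have ss : {subset sort r s <= s} by move=> a; rewrite mem_sort.
move: (sort r s) sort_size ss => [|a1 [|a2 [|m [|b1 [|b2 []]]]]] //= _ ss.
rewrite !inE !negb_or !andbT.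
move=> /and4P[/and4P[a12 a1m _ _] /and3P[a2m _ _] /andP[mb1 mb2] b12].
move=> /and4P[ra12 ra2m rmb1 rb12].
have [a1s a2s ms b1s b2s] :
    [/\ a1 \in s, a2 \in s, m \in s, b1 \in s & b2 \in s].
  by split; apply: ss; rewrite !inE eqxx ?orbT.
have ra1m := r_trans _ _ _ a2s a1s ms ra12 ra2m.
have rmb2 := r_trans _ _ _ b1s ms b2s rmb1 rb12.
exists m => // D i j pD Df.
have surrounded k : (forall a, a \in s -> a != m -> a != k -> D (f a)) ->
    D (f m).
  move=> Dk; have [a [as_ ram Da]] : exists a, [/\ a \in s, r a m & D (f a)].
    have [a1k|a1k] := eqVneq a1 k; last first.
      by exists a1; split=> //; exact: Dk.
    by exists a2; split=> //; apply: Dk => //; rewrite -a1k eq_sym.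
  have [b [bs rmb Db]] : exists b, [/\ b \in s, r m b & D (f b)].
    have [b1k|b1k] := eqVneq b1 k.
      by exists b2; split=> //; apply: Dk; rewrite // eq_sym -?b1k.
    by exists b1; split=> //; apply: Dk; rewrite // eq_sym.
  have [E [pE Ea Em Eb]] := common a m b as_ ms bs.
  exact: (pointed_cone_between pE Ea Em Eb).
have [mi|mi] := eqVneq m i; first by apply: (surrounded j); rewrite mi.
have [mj|mj] := eqVneq m j; last exact: Df.
by apply: (surrounded i) => a as_ am ai; apply: Df; rewrite -?mj.
Qed.

Definition pairwise_dir (n : nat) (D : 'I_n -> 'I_n -> set 'rV[R]_2)
    (A : {set 'I_n}) u :=
  forall i j, i \in A -> j \in A -> (i < j)%N -> D i j u.

(* A direction [f a] common to the cones that avoid a given index [a] exists by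
   induction; the median of five of them lies in all the cones. *)
Lemma pointed_cone_helly (n : nat) (D : 'I_n -> 'I_n -> set 'rV[R]_2) :
  (forall i j : 'I_n, (i < j)%N -> pointed_cone (D i j)) ->
  (forall A : {set 'I_n}, #|A| = 4 -> exists u, pairwise_dir D A u) ->
  forall A : {set 'I_n}, (4 <= #|A|)%N -> exists u, pairwise_dir D A u.
Proof.
move=> pD D4 A; have [m] := ubnP #|A|; elim: m A => // m IH A Am.
rewrite leq_eqVlt => /predU1P[/esym/D4//|A5].
have card_rm (B : {set 'I_n}) a : (#|B| <= #|B :\ a|.+1)%N.
  by rewrite (cardsD1 a B) -add1n leq_add2r leq_b1.
have /choice[f fP] (a : 'I_n) : exists u, a \in A -> pairwise_dir D (A :\ a) u.
  have [aA|] := boolP (a \in A); last by exists 0.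
  have cardAa : #|A| = #|A :\ a|.+1 by rewrite (cardsD1 a) aA.
  by have [||u uP] := IH (A :\ a); [lia|lia|exists u].
have [s [s5 us sA]] : exists s : seq 'I_n,
    [/\ size s = 5, uniq s & {subset s <= A}].
  exists (take 5 (enum A)).
  rewrite size_takel -?cardE // take_uniq ?enum_uniq //.
  by split=> // a /mem_take; rewrite mem_enum.
have [a b c /sA aA /sA bA /sA cA|k /sA kA kP] :=
    pointed_cone_median (f := f) us s5.
  have /card_gt1P[i [j []]] : (1 < #|A :\ a :\ b :\ c|)%N.
    move: A5 => /leq_trans/(_ (card_rm A a)); rewrite ltnS.
    move=> /leq_trans/(_ (card_rm _ b)); rewrite ltnS.
    by move=> /leq_trans/(_ (card_rm _ c)).
  rewrite !inE => /and4P[ic ib ia iA] /and4P[jc jb ja jA] ij.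
  wlog lt_ij : i j iA jA ia ib ic ja jb jc ij / (i < j)%N.
    move=> reduce; case: (ltngtP i j) => [?|?|/val_inj eq_ij].
    - exact: (reduce i j).
    - by apply: (reduce j i) => //; rewrite eq_sym.
    - by rewrite eq_ij eqxx in ij.
  exists (D i j); split; first exact: pD.
  - by apply: fP; rewrite // !inE ?ia ?ja.
  - by apply: fP; rewrite // !inE ?ib ?jb.
  - by apply: fP; rewrite // !inE ?ic ?jc.
exists (f k) => i j iA jA ij; apply: (kP _ i j); first exact: pD.
by move=> a /sA aA ai aj; apply: fP; rewrite // !inE ?iA ?jA eq_sym ?ai ?aj.
Qed.

End PlaneGeometry.

(** * Compactness and convexity in the plane *)

Lemma compact_near (X : topologicalType) (T : Type) (F : set_system T)
    {FF : Filter F} (K : set X) (P : T -> X -> Prop) : compact K ->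
  (forall x, K x -> \forall z \near filter_prod (nbhs x) F, P z.2 z.1) ->
  \forall t \near F, forall x, K x -> P t x.
Proof.
by move=> /compact_near_coveringP cK KP; apply: (cK _ F P) => x /KP.
Qed.

Lemma connected_near_dichotomy (T : topologicalType) (A : set T)
    (P Q : T -> Prop) (a b : T) : connected A ->
  (forall t, A t -> P t -> \forall s \near t, P s) ->
  (forall t, A t -> Q t -> \forall s \near t, Q s) ->
  (forall t, A t -> P t \/ Q t) -> (forall t, A t -> P t -> ~ Q t) ->
  A a -> P a -> A b -> P b.
Proof.
move=> cA oP oQ PQ PNQ Aa Pa Ab.
suff AP : A `&` P = A by move: Ab; rewrite -AP => -[].
apply: cA; first by exists a.
- exists P°; first exact: open_interior.
  by apply/seteqP; split=> t [At Pt]; split=> //;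
    [exact: oP|exact: interior_subset].
- exists (~` Q°); first by rewrite closedC; exact: open_interior.
  apply/seteqP; split=> t [At Pt]; split=> //.
    by move=> /interior_subset; exact: PNQ.
  by have [//|/(oQ t At)] := PQ t At.
Qed.

Lemma cvg_comp_fst (S T U : Type) (F : set_system S) (G : set_system T)
    (H : set_system U) {FG : Filter G} (f : S -> U) :
  f @ F --> H -> f z.1 @[z --> filter_prod F G] --> H.
Proof. by move=> fH; apply: (cvg_comp fst f _ fH); exact: cvg_fst. Qed.

Lemma cvg_comp_snd (S T U : Type) (F : set_system S) (G : set_system T)
    (H : set_system U) {FF : Filter F} (g : T -> U) :
  g @ G --> H -> g z.2 @[z --> filter_prod F G] --> H.
Proof. by move=> gH; apply: (cvg_comp snd g _ gH); exact: cvg_snd. Qed.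

Section PlaneTopology.
Context {R : realType}.
Implicit Types (u v w x y z : 'rV[R]_2) (c e s : R) (C : set 'rV[R]_2).

Lemma convex_setP C : convex_set C <->
  forall x y s, C x -> C y -> 0 <= s -> s <= 1 -> C (s *: x + (1 - s) *: y).
Proof.
split=> [cC x y s Cx Cy s0 s1|cC x y s /set_mem Cx /set_mem Cy].
  by have := cC x y (Itv01 s0 s1); rewrite !inE; apply.
by apply/mem_set; apply: cC.
Qed.

Lemma convex_cross_ivt C u x y c : convex_set C -> C x -> C y ->
  cross u x <= c -> c <= cross u y ->
  exists s, [/\ 0 <= s, s <= 1, C (s *: x + (1 - s) *: y)
              & cross u (s *: x + (1 - s) *: y) = c].
Proof.
move=> /convex_setP cC Cx Cy xc cy.
have [xy|xy] := eqVneq (cross u x) (cross u y).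
  exists 1; rewrite ler01 lexx; split => //; first exact: cC.
  by rewrite !crossE; lra.
have lt_xy : 0 < cross u y - cross u x.
  by rewrite subr_gt0 lt_neqAle xy (le_trans xc).
pose s := (cross u y - c) / (cross u y - cross u x).
have s0 : 0 <= s by rewrite divr_ge0 ?(ltW lt_xy) // subr_ge0.
have s1 : s <= 1 by rewrite ler_pdivrMr // mul1r lerB.
exists s; split => //; first exact: cC.
by rewrite !crossE /s; field; rewrite gt_eqF.
Qed.

Lemma convex_cross_between C u v x y z : convex_set C -> cross u v != 0 ->
  C x -> C z -> cross v x = cross v y -> cross v z = cross v y ->
  cross u x <= cross u y -> cross u y <= cross u z -> C y.
Proof.
move=> vC uv Cx Cz vx vz xy yz.
have [s [_ _ Cs sy]] := convex_cross_ivt vC Cx Cz xy yz.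
suff <- : s *: x + (1 - s) *: z = y by [].
by apply: (cross_inj uv sy); rewrite !crossE vx vz; ring.
Qed.

Lemma cvg_cross (T : Type) (F : set_system T) {FF : Filter F}
    (f g : T -> 'rV[R]_2) u v :
  f @ F --> u -> g @ F --> v -> cross (f t) (g t) @[t --> F] --> cross u v.
Proof.
move=> fu gv.
have coord (h : T -> 'rV[R]_2) w j :
    h @ F --> w -> h t 0 j @[t --> F] --> w 0 j.
  move=> hw; apply: (cvg_comp h (fun x => x 0 j) hw).
  exact: coord_continuous.
by apply: cvgB; apply: cvgM; exact: coord.
Qed.

Lemma near_cross_lt (T : Type) (F : set_system T) {FF : Filter F}
    (f g : T -> 'rV[R]_2) u v c :
  f @ F --> u -> g @ F --> v -> cross u v < c ->
  \forall t \near F, cross (f t) (g t) < c.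
Proof. by move=> fu gv; exact: (cvgr_lt _ (cvg_cross fu gv)). Qed.

Lemma near_cross_gt (T : Type) (F : set_system T) {FF : Filter F}
    (f g : T -> 'rV[R]_2) u v c :
  f @ F --> u -> g @ F --> v -> c < cross u v ->
  \forall t \near F, c < cross (f t) (g t).
Proof. by move=> fu gv; exact: (cvgr_gt _ (cvg_cross fu gv)). Qed.

Lemma near_cross_neq (T : Type) (F : set_system T) {FF : Filter F}
    (f g : T -> 'rV[R]_2) u v c :
  f @ F --> u -> g @ F --> v -> cross u v != c ->
  \forall t \near F, cross (f t) (g t) != c.
Proof.
move=> fu gv; rewrite neq_lt => /orP[uv_lt|uv_gt].
  by apply: filterS (near_cross_lt fu gv uv_lt) => t /lt_eqF/negbT.
by apply: filterS (near_cross_gt fu gv uv_gt) => t /gt_eqF/negbT.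
Qed.

Lemma cross_continuous u : continuous (cross u).
Proof.
move=> x; apply: (@cvg_cross _ (nbhs x) _ (fun=> u) id); last exact: cvg_id.
exact: (cvg_cst u).
Qed.

Lemma compact_cross_min C u : compact C -> C !=set0 ->
  exists2 x, C x & forall y, C y -> cross u x <= cross u y.
Proof.
move=> cC C0; have [|x xC xmin] := compact_EVT_min C0 cC (f := cross u).
  by apply: continuous_subspaceT; exact: cross_continuous.
by exists x; [exact: set_mem|move=> y Cy; apply: xmin; exact: mem_set].
Qed.

Lemma compact_cross_bounded C u : compact C ->
  exists M, forall x, C x -> `|cross u x| <= M.
Proof.
move=> cC; have : compact (cross u @` C).
  apply: continuous_compact => //.
  by apply: continuous_subspaceT; exact: cross_continuous.
move=> /compact_bounded/ex_strict_bound_gt0[M _ bM]; exists M => x Cx.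
by apply/ltW/bM; exists x.
Qed.

Lemma cvg_turn u g (F : set_system R) {FF : Filter F} : F --> (0 : R) ->
  u + t *: g @[t --> F] --> u.
Proof.
move=> F0; rewrite -[X in _ --> X]addr0 -[X in _ --> u + X](scale0r g).
by apply: cvgD; [exact: cvg_cst|apply: cvgZr_tmp].
Qed.

Lemma near_pointed_cone_turn D u v g : pointed_cone D -> D u -> D v ->
  0 < cross u v * cross u g -> \forall s \near 0^'+, D (u + s *: g).
Proof.
move=> pD Du Dv uvg.
have uv0 : cross u v != 0.
  by apply: contraTneq uvg => ->; rewrite mul0r ltxx.
pose a := cross u g / cross u v; pose b := cross v g / cross v u.
have gE : g = a *: v + b *: u.
  rewrite /a /b (crossC v u); move: uv0; rewrite /cross => uv0.
  by apply: rV2P; rewrite !mxE; field.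
have a0 : 0 < a.
  have -> : a = cross u v * cross u g / cross u v ^+ 2 by rewrite /a; field.
  by rewrite divr_gt0 // exprn_even_gt0.
have : \forall s \near 0^'+, 0 < 1 + s * b.
  have : 1 + s * b @[s --> (0 : R)] --> 1 + 0 * b.
    apply: cvgD; first exact: cvg_cst.
    by apply: cvgM; [exact: cvg_id|exact: cvg_cst].
  by move=> /cvg_at_right_filter/cvgr_gt; apply; rewrite mul0r addr0.
move=> sb; near=> s; have s0 : 0 < s by near: s; exact: nbhs_right_gt.
have -> : u + s *: g = (s * a) *: v + (1 + s * b) *: u.
  by rewrite gE scalerDr !scalerA scalerDl scale1r addrCA.
have sa0 : 0 < s * a by exact: mulr_gt0.
have sb0 : 0 < 1 + s * b by near: s.
by apply: pD.2 => //; [exact: ltW|exact: ltW|exact: addr_gt0].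
Unshelve. all: by end_near. Qed.

End PlaneTopology.

(** * Cones over compact convex sets *)

Section ConeOver.
Context {R : realType}.
Implicit Types (u v w x y g h : 'rV[R]_2) (s k : R) (A B S T : set 'rV[R]_2).

Definition cone_over S : set 'rV[R]_2 :=
  [set u | exists v k, [/\ S v, 0 < k & u = k *: v]].

Lemma cone_over_pointed S : convex_set S -> ~ S 0 -> pointed_cone (cone_over S).
Proof.
move=> /convex_setP cS S0; split.
  move=> [v [k [Sv k0 /eqP]]]; rewrite eq_sym scaler_eq0 gt_eqF //= => /eqP v0.
  by apply: S0; rewrite -v0.
move=> _ _ a b [v [k [Sv k0 ->]]] [w [l [Sw l0 ->]]] a0 b0 ab.
have ak0 : 0 <= a * k by rewrite mulr_ge0 // ltW.
have bl0 : 0 <= b * l by rewrite mulr_ge0 // ltW.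
have t0 : 0 < a * k + b * l.
  rewrite lt_neqAle addr_ge0 // andbT eq_sym paddr_eq0 // !mulf_eq0.
  rewrite (gt_eqF k0) (gt_eqF l0) !orbF; apply/negP => /andP[/eqP ? /eqP ?].
  lra.
exists (a * k / (a * k + b * l) *: v + (1 - a * k / (a * k + b * l)) *: w),
  (a * k + b * l); split=> //; last first.
  by apply: rV2P; rewrite !mxE; field; rewrite gt_eqF.
apply: cS => //; first by rewrite divr_ge0 // ltW.
by rewrite ler_pdivrMr // mul1r lerDl.
Qed.

Lemma near_not_cone_over (T : Type) (F : set_system T) {FF : Filter F} S
    (U : T -> 'rV[R]_2) u : compact S -> ~ S 0 -> u != 0 -> U @ F --> u ->
  ~ cone_over S u -> \forall t \near F, ~ cone_over S (U t).
Proof.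
move=> cS S0 u0 Uu uS.
suff : \forall t \near F, forall v, S v ->
    cross (U t) v != 0 \/ cross v (rot90 u) < 0 < cross (U t) (rot90 u).
  apply: filterS => t tS [v [k [Sv k0 UE]]]; have [] := tS v Sv.
    by rewrite UE crossZl crossvv mulr0 eqxx.
  by rewrite UE crossZl pmulr_rgt0 // => /andP[/lt_trans lt /lt]; rewrite ltxx.
apply: compact_near => // v Sv.
have UF : U z.2 @[z --> filter_prod (nbhs v) F] --> u by exact: cvg_comp_snd.
have vF : z.1 @[z --> filter_prod (nbhs v) F] --> v by exact: cvg_fst.
have [uv|uv] := eqVneq (cross u v) 0; last first.
  by apply: filterS (near_cross_neq UF vF uv) => z; left.
have [k kE] := cross_eq0P u0 uv.
have k0 : k < 0.
  rewrite lt_neqAle leNgt; apply/andP; split.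
    by apply/eqP => k0; apply: S0; move: Sv; rewrite kE k0 scale0r.
  apply/negP => k0; apply: uS; exists v, k^-1; split; rewrite ?invr_gt0 //.
  by rewrite kE scalerK // gt_eqF.
have q0 := cross_rot90_gt0 u0.
have vu : cross v (rot90 u) < 0 by rewrite kE crossZl nmulr_rlt0.
apply: filterS2 (near_cross_lt vF (cvg_cst (rot90 u)) vu)
  (near_cross_gt UF (cvg_cst (rot90 u)) q0) => z vz uz.
by right; rewrite vz uz.
Qed.

Lemma compact_convex_half_plane S : compact S -> convex_set S -> ~ S 0 ->
  exists h, forall v, S v -> 0 < cross h v.
Proof.
move=> cS /convex_setP vS S0.
have [Sn0|/set0P/negP/negPn/eqP ->] := pselect (S !=set0); last by exists 0.
have [|m /set_mem Sm m_min] := compact_EVT_min Sn0 cS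
    (f := fun v => cross v (rot90 v)).
  apply: continuous_subspaceT => v; under eq_fun do rewrite cross_rot90.
  have coord j : x 0 j @[x --> v] --> v 0 j by exact: coord_continuous.
  exact: (cvgD (cvgM (coord 0) (coord 0)) (cvgM (coord 1) (coord 1))).
have m0 : m != 0 by apply/eqP => m0; apply: S0; rewrite -m0.
have q0 := cross_rot90_gt0 m0; set q := cross m (rot90 m) in q0.
exists (- rot90 m) => v Sv; rewrite crossNl -crossC ltNge; apply/negP => vm.
pose Q := cross (v - m) (rot90 (v - m)).
have Q0 : 0 <= Q by rewrite /Q cross_rot90 -!expr2 addr_ge0 ?sqr_ge0.
pose s := q / (q + Q).
have s0 : 0 < s by rewrite divr_gt0 //; lra.
have s1 : s <= 1 by rewrite ler_pdivrMr ?mul1r; lra.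
have := m_min _ (mem_set (vS _ _ s Sv Sm (ltW s0) s1)).
have -> : cross (s *: v + (1 - s) *: m) (rot90 (s *: v + (1 - s) *: m)) =
    q + s * (s * Q - 2 * (q - cross v (rot90 m))).
  by rewrite /q /Q !cross_rot90 !mxE; ring.
have sQ : s * Q <= q.
  by rewrite /s mulrAC ler_pdivrMr ?ler_pM2l //; lra.
by rewrite lerDl pmulr_rge0 //; lra.
Qed.

(* In an open half-plane angles are ordered by the slope
   [cross w v / cross h v], for any [w] with [cross h w = 1]. *)
Lemma compact_angular_extremes T h : compact T -> T !=set0 ->
  (forall v, T v -> 0 < cross h v) ->
  exists u v, [/\ T u, T v &
    forall x, T x -> 0 <= cross u x /\ cross v x <= 0].
Proof.
move=> cT T0 hT.
have h0 : h != 0.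
  by apply/eqP => h0; have [v /hT] := T0; rewrite h0 cross0l ltxx.
have [w hw] := cross_eq1 h0; pose slope v := cross w v / cross h v.
have slopeP x y : T x -> T y -> (0 <= cross x y) = (slope x <= slope y).
  move=> /hT hx /hT hy; rewrite /slope ler_pdivrMr // mulrAC ler_pdivlMr //.
  rewrite -[cross x y]mul1r -hw cross_plucker subr_ge0.
  by rewrite [leRHS]mulrC [leLHS]mulrC.
have slope_continuous : {within T, continuous slope}.
  apply: continuous_in_subspaceT => v /set_mem/hT hv.
  have hv0 := lt0r_neq0 hv.
  exact: (cvgM (@cross_continuous R w v) (cvgV hv0 (@cross_continuous R h v))).
have [u /set_mem Tu umin] := compact_EVT_min T0 cT slope_continuous.
have [v /set_mem Tv vmax] := compact_EVT_max T0 cT slope_continuous.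
exists u, v; split=> // x Tx; split; first by rewrite slopeP // umin ?inE.
by rewrite crossC oppr_le0 slopeP // vmax ?inE.
Qed.

Section CommonDirections.
Variables (I : finType) (S : I -> set 'rV[R]_2).
Hypotheses (S_compact : forall i, compact (S i))
  (S_convex : forall i, convex_set (S i)) (S_not0 : forall i, ~ S i 0).

Definition common u := forall i, cone_over (S i) u.

Definition right_extreme u := exists i, forall v, S i v -> 0 <= cross u v.

Let cone_pointed i : pointed_cone (cone_over (S i)).
Proof. exact: cone_over_pointed. Qed.

Lemma commonZ u k : 0 < k -> common (k *: u) -> common u.
Proof.
move=> k0 uS i; rewrite -[u](scalerK (lt0r_neq0 k0)).
by apply: pointed_coneZ; rewrite ?invr_gt0.
Qed.

Lemma compact_common i : compact (S i `&` common).
Proof.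
apply: (subclosed_compact _ (@S_compact i)) => [u uS|u []//].
have Su : S i u.
  apply: (compact_closed (@norm_hausdorff _ _) (@S_compact i)).
  by apply: closureS uS => v [].
split=> // j; apply: contrapT => uSj.
have u0 : u != 0 by apply/eqP => u0; apply: (@S_not0 i); rewrite -u0.
have near_uSj : \forall v \near u, ~ cone_over (S j) v.
  by apply: (@near_not_cone_over _ (nbhs u) _ (S j) id u) => //; exact: cvg_id.
by have [v [[_ vS] nvS]] := uS _ near_uSj; exact: nvS (vS j).
Qed.

Lemma common_turn i u g : common u ->
  (forall j, exists2 v, S j v & 0 < cross u v * cross u g) ->
  exists2 v, (S i `&` common) v & 0 < cross u v * cross u g.
Proof.
move=> uS turn.
have : \forall s \near 0^'+, forall j, cone_over (S j) (u + s *: g).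
  apply: filter_forall => j; have [v Sv uv] := turn j.
  apply: near_pointed_cone_turn uv => //.
  by exists v, 1; rewrite scale1r.
move=> /(filterI (nbhs_right_gt 0))/filter_ex[s [s0 sS]].
have [v [k [Sv k0 sE]]] := sS i; exists v.
  by split=> //; apply: (commonZ k0); rewrite -sE.
have ug : cross u g != 0.
  have [x _] := turn i; apply: contraTneq => ->.
  by rewrite mulr0 ltxx.
have uvE : k * cross u v = s * cross u g.
  by rewrite -crossZr -sE crossDr crossvv add0r crossZr.
by rewrite -(pmulr_rgt0 _ k0) mulrA uvE -mulrA -expr2 mulr_gt0 //
  exprn_even_gt0.
Qed.

Lemma common_extremes (i : I) : (exists u, common u) ->
  exists u v, [/\ common u, common v, right_extreme u & right_extreme (- v)].
Proof.
move=> [t tS]; have [h hS] := compact_convex_half_plane (@S_compact i)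
  (@S_convex i) (@S_not0 i).
have T0 : S i `&` common !=set0.
  have [v [k [Sv k0 tE]]] := tS i; exists v; split=> //.
  by apply: (commonZ k0); rewrite -tE.
have [u [v [[Su uS] [Sv vS] uv]]] := compact_angular_extremes
  (@compact_common i) T0 (fun x Tx => hS x Tx.1).
have turn w g : common w -> ~ (exists j, forall x, S j x ->
    cross w x * cross w g <= 0) ->
    exists2 x, (S i `&` common) x & 0 < cross w x * cross w g.
  move=> wS nex; apply: common_turn => // j.
  apply: contrapT => njx; apply: nex; exists j => x Sx; rewrite leNgt.
  by apply/negP => lt; apply: njx; exists x.
have uh : cross u h < 0 by rewrite crossC oppr_lt0 hS.
have vh : cross v h < 0 by rewrite crossC oppr_lt0 hS.
exists u, v; split=> //; apply: contrapT => next.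
- have [|x /uv[ux _]] := turn u h uS; last by rewrite nmulr_lgt0 // ltNge ux.
  by move=> [j jP]; apply: next; exists j => x /jP; rewrite nmulr_lle0.
have [|x /uv[_ vx]] := turn v (- h) vS; last first.
  by rewrite crossNr mulrN oppr_gt0 nmulr_llt0 // ltNge vx.
move=> [j jP]; apply: next; exists j => x /jP.
by rewrite crossNr crossNl mulrN !oppr_le0 oppr_ge0 nmulr_lge0.
Qed.

End CommonDirections.

End ConeOver.

(** * Side conditions *)

Section SideConditions.
Context {R : realType}.
Implicit Types (u v w x y z : 'rV[R]_2) (b c e : R) (C : set 'rV[R]_2)
  (P : 'rV[R]_2 -> R -> Prop).

(* A pair [(u, c)] with [u != 0] stands for the line [cross u x = c] directed
   by [u], and [(- u, - c)] for the same line with the opposite direction;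
   [P u c] says that the part of [C] to the right of the line is not too
   small. *)
Definition stabs P u c := P u c /\ P (- u) (- c).

Definition side_meets C P := forall u c, P u c ->
  exists2 x, C x & cross u x <= c.

Definition no_crossing C u c v b :=
  cross u v != 0 -> forall x, C x -> cross u x = c -> cross v x <> b.

(* A stabber can be rotated about any point outside of [C]. *)
Definition side_rotates C P := forall u c v b x, u != 0 -> v != 0 ->
  stabs P v b -> C x -> cross v x = b -> cross u x <= c ->
  no_crossing C u c v b -> P u c.

Definition side_limit C P u c := forall e, 0 < e -> exists v b, P v b /\
  forall x, C x -> `|(cross v x - b) - (cross u x - c)| <= e.

Definition side_closed_at C P u c :=
  side_limit C P u c -> side_limit C P (- u) (- c) -> stabs P u c.

Definition side_closed C P := forall u c, u != 0 -> side_closed_at C P u c.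

Lemma stabsN P u c : stabs P u c -> stabs P (- u) (- c).
Proof. by case=> ? ?; split; rewrite ?opprK. Qed.

Lemma stabs_meets C P u c : convex_set C -> side_meets C P -> stabs P u c ->
  exists2 x, C x & cross u x = c.
Proof.
move=> vC mC [/mC[x Cx xc] /mC[y Cy]]; rewrite crossNl lerN2 => yc.
by have [s [_ _ ? ?]] := convex_cross_ivt vC Cx Cy xc yc; eexists; eauto.
Qed.

Lemma no_crossingN C u c v b : no_crossing C u c v b ->
  no_crossing C (- u) (- c) v b.
Proof.
move=> nc uv x Cx; rewrite crossNl => /oppr_inj; apply: nc => //.
by rewrite -oppr_eq0 -crossNl.
Qed.

Lemma side_crossing C P u c v b x : side_rotates C P -> u != 0 -> v != 0 ->
  ~ P u c -> stabs P v b -> C x -> cross v x = b -> cross u x <= c ->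
  exists z, [/\ C z, cross u z = c, cross v z = b & cross u v != 0].
Proof.
move=> rC u0 v0 nP vb Cx xb xc; apply: contrapT => nex; apply: nP.
by apply: (rC u c v b x) => // uv z Cz zc zb; apply: nex; exists z.
Qed.

Lemma stabs_rotate C P u c v b w d x y : side_rotates C P ->
  u != 0 -> v != 0 -> w != 0 -> stabs P u c -> stabs P w d ->
  C x -> C y -> cross u x = c -> cross w y = d ->
  (cross v x - b) * (cross v y - b) <= 0 ->
  no_crossing C v b u c -> no_crossing C v b w d -> stabs P v b.
Proof.
move=> rC u0 v0 w0 uc wd Cx Cy xc yd xy ncu ncw.
have vN0 : - v != 0 by rewrite oppr_eq0.
have [xb|xb] := lerP (cross v x) b.
  have [yb|yb] := lerP b (cross v y).
    split; first exact: (rC _ _ u c x).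
    by apply: (rC _ _ w d y) => //; [rewrite crossNl lerN2|exact: no_crossingN].
  split; first by apply: (rC _ _ w d y) => //; exact: ltW.
  apply: (rC _ _ u c x) => //; last exact: no_crossingN.
  by rewrite crossNl lerN2; nra.
split; first by apply: (rC _ _ w d y) => //; nra.
apply: (rC _ _ u c x) => //; last exact: no_crossingN.
by rewrite crossNl lerN2 ltW.
Qed.

Lemma stabs_parallel C P u v c x : side_rotates C P -> u != 0 -> v != 0 ->
  cross v u = 0 -> C x -> cross u x = c -> stabs P u c ->
  stabs P v (cross v x).
Proof.
move=> rC u0 v0 vu Cx xc uc.
apply: (stabs_rotate rC u0 v0 u0 uc uc Cx Cx) => //.
- by rewrite subrr mul0r.
- by rewrite /no_crossing vu eqxx.
- by rewrite /no_crossing vu eqxx.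
Qed.

Lemma compact_near_cross_uniform (T : Type) (F : set_system T) {FF : Filter F}
    C (U : T -> 'rV[R]_2) (g : T -> R) u c e :
  compact C -> U @ F --> u -> g @ F --> c -> 0 < e ->
  \forall t \near F, forall x, C x ->
    `|(cross (U t) x - g t) - (cross u x - c)| <= e.
Proof.
move=> cC Uu gc e0.
apply: (@compact_near _ _ F _ C (fun t x =>
  `|(cross (U t) x - g t) - (cross u x - c)| <= e)) => // x Cx.
have xF : z.1 @[z --> filter_prod (nbhs x) F] --> x by exact: cvg_fst.
have UF : U z.2 @[z --> filter_prod (nbhs x) F] --> u by exact: cvg_comp_snd.
have gF : g z.2 @[z --> filter_prod (nbhs x) F] --> c by exact: cvg_comp_snd.
have uF : u @[_ --> filter_prod (nbhs x) F] --> u by exact: cvg_cst.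
have cF : c @[_ --> filter_prod (nbhs x) F] --> c by exact: cvg_cst.
have lim0 : (cross (U z.2) z.1 - g z.2) - (cross u z.1 - c)
    @[z --> filter_prod (nbhs x) F] --> (0 : R).
  rewrite -(subrr (cross u x - c)).
  by apply: cvgB; apply: cvgB => //; exact: cvg_cross.
exact: (cvgr0_norm_le _ lim0).
Qed.

Lemma near_not_stabs (T : Type) (F : set_system T) {FF : Filter F} C P
    (U : T -> 'rV[R]_2) (g : T -> R) u c :
  compact C -> side_closed_at C P u c ->
  U @ F --> u -> g @ F --> c -> ~ stabs P u c ->
  \forall t \near F, ~ stabs P (U t) (g t).
Proof.
move=> cC clC Uu gc ns; apply: contrapT => nnear; apply: ns.
have approx e : 0 < e -> exists2 t, stabs P (U t) (g t) & forall x, C x ->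
    `|(cross (U t) x - g t) - (cross u x - c)| <= e.
  move=> e0; apply: contrapT => nex; apply: nnear.
  apply: filterS (compact_near_cross_uniform cC Uu gc e0) => t tP st.
  by apply: nex; exists t.
apply: clC => e /approx[t [s1 s2] tP]; first by exists (U t), (g t).
exists (- U t), (- g t); split=> // x /tP.
by rewrite !crossNl -!opprD normrN.
Qed.

End SideConditions.

(** * Directions from one set to another *)

Section Directions.
Context {R : realType}.
Implicit Types (u v x y : 'rV[R]_2) (A B : set 'rV[R]_2).

Definition differences A B : set 'rV[R]_2 := [set y - x | x in A & y in B].

Definition dir_cone A B := cone_over (differences A B).

Lemma compact_differences A B : compact A -> compact B ->
  compact (differences A B).
Proof.
move=> cA cB.
have -> : differences A B = (fun z => z.2 - z.1) @` (A `*` B).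
  apply/seteqP; split=> [_ [x Ax [y By <-]]|_ [[x y] [Ax By] <-]].
    by exists (x, y).
  by exists x => //; exists y.
apply: continuous_compact; last exact: compact_setX.
apply: continuous_subspaceT => z.
by apply: cvgB; [exact: cvg_snd|exact: cvg_fst].
Qed.

Lemma convex_differences A B : convex_set A -> convex_set B ->
  convex_set (differences A B).
Proof.
move=> /convex_setP cA /convex_setP cB; apply/convex_setP.
move=> _ _ s [x Ax [y By <-]] [x' Ax' [y' By' <-]] s0 s1.
exists (s *: x + (1 - s) *: x'); first exact: cA.
exists (s *: y + (1 - s) *: y'); first exact: cB.
by apply: rV2P; rewrite !mxE; ring.
Qed.

Lemma differences_not0 A B : A `&` B = set0 -> ~ differences A B 0.
Proof.
move=> AB0 [x Ax [y By /eqP]]; rewrite subr_eq0 => /eqP yx.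
by have : (A `&` B) x; [split=> //; rewrite -yx|rewrite AB0].
Qed.

Lemma disjoint_neq A B x y : A `&` B = set0 -> A x -> B y -> y - x != 0.
Proof.
move=> AB0 Ax By; apply/eqP => yx; apply: (differences_not0 AB0).
by exists x => //; exists y.
Qed.

Lemma disjoint_notin A B x : A `&` B = set0 -> A x -> ~ B x.
Proof. by move=> AB0 Ax Bx; have : (A `&` B) x by []; rewrite AB0. Qed.

Lemma dir_coneB A B x y : A x -> B y -> dir_cone A B (y - x).
Proof.
by move=> Ax By; exists (y - x), 1; rewrite scale1r; split=> //;
  exists x => //; exists y.
Qed.

Lemma dir_cone_pointed A B : convex_set A -> convex_set B -> A `&` B = set0 ->
  pointed_cone (dir_cone A B).
Proof.
move=> vA vB AB0; apply: cone_over_pointed; first exact: convex_differences.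
exact: differences_not0.
Qed.

Lemma dir_cone_line A B u x y : pointed_cone (dir_cone A B) ->
  dir_cone A B u -> A x -> B y -> cross u x = cross u y ->
  exists2 k, 0 < k & y - x = k *: u.
Proof.
move=> pAB uAB Ax By xy; apply: (pointed_cone_collinear pAB uAB).
  exact: dir_coneB.
by rewrite crossBr xy subrr.
Qed.

Lemma near_not_dir_cone (T : Type) (F : set_system T) {FF : Filter F} A B
    (U : T -> 'rV[R]_2) u : compact A -> compact B -> A `&` B = set0 ->
  u != 0 -> U @ F --> u -> ~ dir_cone A B u ->
  \forall t \near F, ~ dir_cone A B (U t).
Proof.
move=> cA cB AB0; apply: near_not_cone_over; first exact: compact_differences.
exact: differences_not0.
Qed.

End Directions.

(** * Stabbing in order *)

Lemma exists_itv_neq (R : realFieldType) (a b d : R) : a < b ->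
  exists2 c, a < c < b & c != d.
Proof.
move=> ab; have [mid_d|] := eqVneq ((a + b) / 2) d; last first.
  by exists ((a + b) / 2) => //; apply/andP; split; lra.
exists ((a + 2 * b) / 3); first by apply/andP; split; lra.
by apply/eqP; lra.
Qed.

Lemma superset_card (n m : nat) (A : {set 'I_n}) :
  (#|A| <= m)%N -> (m <= n)%N ->
  exists2 B : {set 'I_n}, A \subset B & #|B| = m.
Proof.
elim: m => [|m IH] Am mn; first by exists A => //; apply/eqP; rewrite -leqn0.
move: Am; rewrite leq_eqVlt => /predU1P[Am|Am]; first by exists A.
have [B AB Bm] := IH Am (ltnW mn).
have /card_gt0P[x] : (0 < #|~: B|)%N.
  by have := cardsC B; rewrite Bm card_ord; lia.
rewrite !inE => xB; exists (x |: B); last by rewrite cardsU1 xB Bm.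
by rewrite (fintype.subset_trans AB) // finset.subsetUr.
Qed.

Lemma ltn_ord_neq (n : nat) (i j : 'I_n) : (i < j)%N -> i != j.
Proof. by apply: contraTneq => ->; rewrite ltnn. Qed.

Lemma family_cone_pointed (R : realType) (n : nat) (C : 'I_n -> set 'rV[R]_2) :
  (forall i j, i != j -> C i `&` C j = set0) -> (forall i, convex_set (C i)) ->
  forall i j : 'I_n, (i < j)%N -> pointed_cone (dir_cone (C i) (C j)).
Proof.
by move=> dC vC i j ij; apply: dir_cone_pointed => //; exact/dC/ltn_ord_neq.
Qed.

Section StabbedInOrder.
Context {R : realType} (n : nat).
Variables (C : 'I_n -> set 'rV[R]_2) (P : 'I_n -> 'rV[R]_2 -> R -> Prop).
Implicit Types (A B : {set 'I_n}) (u : 'rV[R]_2).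

Definition ordered_on A u := pairwise_dir (fun i j => dir_cone (C i) (C j)) A u.

Definition stabbed_in_order A := exists u c,
  [/\ u != 0, forall i, i \in A -> stabs (P i) u c & ordered_on A u].

Lemma ordered_onS A B u : A \subset B -> ordered_on B u -> ordered_on A u.
Proof.
by move=> /fintype.subsetP AB ord i j /AB iB /AB jB; exact: ord.
Qed.

Lemma stabbed_in_orderS A B : A \subset B -> stabbed_in_order B ->
  stabbed_in_order A.
Proof.
move=> AB [u [c [u0 st ord]]]; exists u, c; split=> //.
  by move=> i /(fintype.subsetP AB); exact: st.
exact: ordered_onS ord.
Qed.

Lemma stabbed_in_order_seq (s : seq 'I_n) : (4 <= n)%N -> (size s <= 4)%N ->
  (forall A : {set 'I_n}, #|A| = 4 -> stabbed_in_order A) ->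
  stabbed_in_order [set i in s]%SET.
Proof.
move=> hn s4 four; have [||A sA A4] := @superset_card n 4 [set i in s]%SET.
- by rewrite cardsE (leq_trans (card_size s)).
- exact: hn.
exact: stabbed_in_orderS sA (four A A4).
Qed.

End StabbedInOrder.

(** * The ordered transversal theorem for closed side conditions *)

Section OrderedStabbing.
Context {R : realType} (n : nat) (hn : (4 <= n)%N).
Variables (C : 'I_n -> set 'rV[R]_2) (P : 'I_n -> 'rV[R]_2 -> R -> Prop).
Hypotheses (C_disjoint : forall i j : 'I_n, i != j -> C i `&` C j = set0)
  (C_compact : forall i, compact (C i)) (C_convex : forall i, convex_set (C i))
  (P_meets : forall i, side_meets (C i) (P i))
  (P_rotates : forall i, side_rotates (C i) (P i))
  (four : forall A : {set 'I_n}, #|A| = 4 -> stabbed_in_order C P A).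
Implicit Types (u v w x y z : 'rV[R]_2) (c e s t : R) (i j k p q : 'I_n).

Let cone_pointed := family_cone_pointed C_disjoint C_convex.

Let index0 : 'I_n := Ordinal (leq_trans (isT : (0 < 4)%N) hn).

Let index1 : 'I_n := Ordinal (leq_trans (isT : (1 < 4)%N) hn).

Let stabs_meets_member i u c (st : stabs (P i) u c) :
  exists2 x, C i x & cross u x = c := stabs_meets (@C_convex i) (@P_meets i) st.

Definition pair_stabber p q x y := [/\ C p x, C q y,
  stabs (P p) (y - x) (cross (y - x) x) &
  stabs (P q) (y - x) (cross (y - x) x)].

Lemma pair_stabberC p q x y : pair_stabber p q x y -> pair_stabber q p y x.
Proof.
case=> Cx Cy sp sq; have yx : cross (x - y) y = - cross (y - x) x.
  by rewrite -crossNl opprB cross_endpoints.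
by split=> //; rewrite yx -opprB; exact: stabsN.
Qed.

Lemma line_pair_stabber p q u c x y : p != q -> u != 0 -> stabs (P p) u c ->
  stabs (P q) u c -> C p x -> C q y -> cross u x = c -> cross u y = c ->
  pair_stabber p q x y.
Proof.
move=> pq u0 sp sq Cx Cy xc yc.
have v0 := disjoint_neq (C_disjoint pq) Cx Cy.
have vu : cross (y - x) u = 0 by rewrite crossC crossBr xc yc subrr oppr0.
split=> //; first exact: (stabs_parallel (@P_rotates p) u0 v0 vu Cx xc sp).
rewrite -cross_endpoints.
exact: (stabs_parallel (@P_rotates q) u0 v0 vu Cy yc sq).
Qed.

Lemma ordered_pair_stabber p q u c : (p < q)%N -> u != 0 -> stabs (P p) u c ->
  stabs (P q) u c -> dir_cone (C p) (C q) u ->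
  exists x y (k : R), [/\ pair_stabber p q x y, 0 < k & y - x = k *: u].
Proof.
move=> pq u0 sp sq upq.
have [x Cx xc] := stabs_meets_member sp.
have [y Cy yc] := stabs_meets_member sq.
have [|k k0 kE] := dir_cone_line (cone_pointed pq) upq Cx Cy.
  by rewrite xc yc.
exists x, y, k; split=> //.
exact: line_pair_stabber (ltn_ord_neq pq) u0 sp sq Cx Cy xc yc.
Qed.

Lemma parallel_pair_stabbers p q i j : (p < q)%N -> (i < j)%N ->
  exists x y x' y' (k : R), [/\ pair_stabber p q x y, pair_stabber i j x' y',
    0 < k & y' - x' = k *: (y - x)].
Proof.
move=> pq ij.
have [v [c [v0 st ord]]] :=
  stabbed_in_order_seq (s := [:: p; q; i; j]) hn isT four.
have [p4 q4 i4 j4] : let A := [set k in [:: p; q; i; j]]%SET in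
    [/\ p \in A, q \in A, i \in A & j \in A].
  by split; rewrite !inE eqxx ?orbT.
have [x [y [k [xy k0 kE]]]] :=
  ordered_pair_stabber pq v0 (st p p4) (st q q4) (ord p q p4 q4 pq).
have [x' [y' [k' [xy' k0' kE']]]] :=
  ordered_pair_stabber ij v0 (st i i4) (st j j4) (ord i j i4 j4 ij).
exists x, y, x', y', (k' / k); split => //; first exact: divr_gt0.
by rewrite kE kE' scalerA divfK // gt_eqF.
Qed.

(* Otherwise the pair stabber can be rotated onto the line [(u, c)] only across
   [C p] or [C q], and the crossing point leads to a point of both sets. *)
Lemma pair_stabber_turns_right p q u c x y : p != q -> u != 0 -> ~ P p u c ->
  ~ P q (- u) (- c) -> pair_stabber p q x y -> cross u (y - x) < 0.
Proof.
move=> pq u0 nPp nPq [Cx Cy sp sq].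
have v0 := disjoint_neq (C_disjoint pq) Cx Cy.
rewrite crossBr subr_lt0 ltNge; apply/negP => xy.
set v := y - x in sp sq v0.
have vxy : cross v y = cross v x by exact: cross_endpoints.
have crossing_p : cross u x <= c -> exists z, [/\ C p z, cross u z = c,
    cross v z = cross v x & cross u v != 0].
  exact: (side_crossing (@P_rotates p) u0 v0 nPp sp Cx erefl).
have crossing_q : c <= cross u y -> exists z, [/\ C q z, cross u z = c,
    cross v z = cross v x & cross u v != 0].
  move=> cy; have [||z [Cz zc zv uv]] :=
      side_crossing (@P_rotates q) _ v0 nPq sq Cy vxy.
  - by rewrite oppr_eq0.
  - by rewrite crossNl lerN2.
  exists z; split=> //; last by rewrite -oppr_eq0 -crossNl.
  by move: zc; rewrite crossNl => /oppr_inj.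
have [xc|cx] := lerP (cross u x) c; last first.
  have [|z [Cz zc zv uv]] := crossing_q.
    by rewrite ltW // (lt_le_trans cx).
  apply: (disjoint_notin (C_disjoint pq) Cx).
  by apply: (convex_cross_between _ uv Cz Cy) => //; rewrite zc ltW.
have [z [Cz zc zv uv]] := crossing_p xc.
have [cy|yc] := lerP c (cross u y).
  have [z' [Cz' zc' zv' _]] := crossing_q cy.
  apply: (disjoint_notin (C_disjoint pq) Cz).
  suff -> : z = z' by [].
  by apply: (cross_inj uv); [rewrite zc zc'|rewrite zv zv'].
apply: (disjoint_notin (C_disjoint pq) _ Cy).
by apply: (convex_cross_between _ uv Cx Cz) => //; rewrite ?zv ?zc // ltW.
Qed.

Definition forces_right u := exists p q, (p < q)%N /\
  forall x y, pair_stabber p q x y -> cross u (y - x) < 0.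

Definition left_pair p q u :=
  exists x y, pair_stabber p q x y /\ 0 < cross u (y - x).

Definition straddled i u := (forall c, ~ stabs (P i) u c) /\
  forall k, k != i -> left_pair i k u /\ left_pair k i u.

Definition gap i u c := ~ P i u c /\ ~ P i (- u) (- c).

Lemma forces_rightN u : forces_right u -> ~ forces_right (- u).
Proof.
move=> [p [q [pq uP]]] [i [j [ij vP]]].
have [x [y [x' [y' [k [xy xy' k0 kE]]]]]] := parallel_pair_stabbers pq ij.
move: (uP _ _ xy) (vP _ _ xy'); rewrite kE crossNl !crossZr.
by rewrite oppr_lt0 pmulr_rgt0 //; lra.
Qed.

Lemma left_pairN p q u : left_pair p q (- u) -> left_pair q p u.
Proof.
move=> [x [y [xy uxy]]]; exists y, x; split; first exact: pair_stabberC.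
by rewrite -opprB crossNr -crossNl.
Qed.

Lemma straddledN i u : straddled i u -> straddled i (- u).
Proof.
move=> [ns sides]; split=> [c st|k /sides[ik ki]].
  by have := stabsN st; rewrite opprK; exact: ns.
by split; apply: left_pairN; rewrite opprK.
Qed.

Lemma pair_stabber_cross_neq0 i p q u x y : u != 0 ->
  (forall c, ~ stabs (P i) u c) -> p != q -> i \in [:: p; q] ->
  pair_stabber p q x y -> cross u (y - x) != 0.
Proof.
move=> u0 ns pq; wlog ip : p q x y pq / i = p.
  move=> reduce; rewrite !inE => /orP[/eqP ip|/eqP iq] xy.
    by apply: (reduce p q); rewrite // inE ip eqxx.
  rewrite -opprB crossNr oppr_eq0; apply: (reduce q p) => //.
  - by rewrite eq_sym.
  - by rewrite inE iq eqxx.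
  - exact: pair_stabberC.
move=> _ [Cx Cy sp _]; apply/eqP => uv; apply: (ns (cross u x)).
have v0 := disjoint_neq (C_disjoint pq) Cx Cy.
rewrite -ip in Cx sp.
exact: (stabs_parallel (@P_rotates i) v0 u0 uv Cx erefl sp).
Qed.

Lemma not_forces_right_left_pair i p q u : u != 0 -> ~ forces_right u ->
  (forall c, ~ stabs (P i) u c) -> (p < q)%N -> i \in [:: p; q] ->
  left_pair p q u.
Proof.
move=> u0 nfr ns pq ipq; apply: contrapT => nleft; apply: nfr.
exists p, q; split=> // x y xy; rewrite lt_neqAle.
rewrite (pair_stabber_cross_neq0 u0 ns (ltn_ord_neq pq) ipq xy) leNgt.
by apply/negP => uxy; apply: nleft; exists x, y.
Qed.

Lemma gap_not_stabs i u c d : u != 0 -> gap i u c -> ~ stabs (P i) u d.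
Proof.
move=> u0 [nP nPN] sd.
have [x Cx xd] := stabs_meets_member sd.
have par w b : no_crossing (C i) w b w d.
  by rewrite /no_crossing crossvv eqxx.
have [dc|/ltW cd] := lerP d c.
  by apply: nP; apply: (P_rotates u0 u0 sd Cx xd) => //; rewrite xd.
apply: nPN; apply: (P_rotates _ u0 sd Cx xd); rewrite ?oppr_eq0 //.
  by rewrite crossNl xd lerN2.
by apply: no_crossingN; exact: par.
Qed.

Lemma gap_straddled i u c : u != 0 -> gap i u c -> ~ forces_right u ->
  ~ forces_right (- u) -> straddled i u.
Proof.
move=> u0 gap_c nfr nfrN; have uN0 : - u != 0 by rewrite oppr_eq0.
have ns d : ~ stabs (P i) u d by exact: gap_not_stabs gap_c.
have nsN d : ~ stabs (P i) (- u) d.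
  by move=> st; have := stabsN st; rewrite opprK; exact: ns.
split=> // k ki.
have [ik|ik|/val_inj eq_ik] := ltngtP i k; last by rewrite eq_ik eqxx in ki.
- have ipq : i \in [:: i; k] by rewrite inE eqxx.
  split; first exact: not_forces_right_left_pair ipq.
  by apply: left_pairN; exact: not_forces_right_left_pair ipq.
have ipq : i \in [:: k; i] by rewrite !inE eqxx orbT.
split; last exact: not_forces_right_left_pair ipq.
by apply: left_pairN; exact: not_forces_right_left_pair ipq.
Qed.

Hypothesis P_closed : forall i, side_closed (C i) (P i).

(* The offset [d] is exempted so that a failure can be located away from any
   prescribed place. *)
Lemma stabs_of_cut (S : pred 'I_n) u d : u != 0 -> (exists i, S i) ->
  (forall c, c != d ->
    (forall i, S i -> P i u c) \/ (forall i, S i -> P i (- u) (- c))) ->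
  exists c, forall i, S i -> stabs (P i) u c.
Proof.
move=> u0 [i0 Si0] cut.
have [M bM] := compact_cross_bounded u (@C_compact i0).
pose A := [set c | forall i, S i -> P i u c].
have infA : has_inf A.
  split.
    have [|c /andP[Mc _] cd] := @exists_itv_neq R M (M + 1) d; first lra.
    exists c => i Si; have [h|/(_ _ Si0)/P_meets[x /bM]] := cut c cd.
      exact: h.
    by rewrite crossNl lerN2 ler_norml => /andP[]; lra.
  exists (- M) => c /(_ _ Si0)/P_meets[x /bM].
  by rewrite ler_norml => /andP[]; lra.
exists (inf A) => i Si; apply: P_closed u0 _ _ => e e0.
  have [a Aa ae] := inf_adherent e0 infA.
  have le_inf : inf A <= a by apply: ge_inf infA.2 _ Aa.
  exists u, a; split=> [|x _]; first exact: Aa.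
  by rewrite ler_norml; apply/andP; split; lra.
have [|c /andP[ec cA] cd] := @exists_itv_neq R (inf A - e) (inf A) d; first lra.
exists (- u), (- c); split=> [|x _].
  have [Ac|] := cut c cd; last by apply.
  by have := ge_inf infA.2 Ac; lra.
by rewrite ler_norml; apply/andP; split; lra.
Qed.

Lemma obstructing_sides u : u != 0 -> ~ (exists c, forall i, stabs (P i) u c) ->
  exists p q c, ~ P p u c /\ ~ P q (- u) (- c).
Proof.
move=> u0 none; apply: contrapT => nex; apply: none.
have [||c cP] := @stabs_of_cut xpredT u 0 u0.
- by exists index0.
- move=> c _; apply: contrapT => /not_orP[/existsNP[p /not_implyP[_ np]]].
  by move=> /existsNP[q /not_implyP[_ nq]]; apply: nex; exists p, q, c.
by exists c => i; exact: cP.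
Qed.

Lemma direction_trichotomy u : u != 0 ->
  ~ (exists c, forall i, stabs (P i) u c) ->
  [\/ forces_right u, forces_right (- u) | exists i, straddled i u].
Proof.
move=> u0 /(obstructing_sides u0)[p [q [c [nPp nPq]]]].
have uN0 : - u != 0 by rewrite oppr_eq0.
have [pq|qp|/val_inj eq_pq] := ltngtP p q.
- apply: Or31; exists p, q; split=> // x y.
  exact: pair_stabber_turns_right (ltn_ord_neq pq) u0 nPp nPq.
- apply: Or32; exists q, p; split=> // x y.
  apply: (pair_stabber_turns_right (ltn_ord_neq qp) uN0 nPq).
  by rewrite !opprK.
have [?|nfr] := pselect (forces_right u); first exact: Or31.
have [?|nfrN] := pselect (forces_right (- u)); first exact: Or32.
rewrite -eq_pq in nPq; apply: Or33; exists p.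
exact: gap_straddled u0 (conj nPp nPq) nfr nfrN.
Qed.

Lemma straddled_gap i u d : u != 0 -> straddled i u ->
  exists2 c, c != d & gap i u c.
Proof.
move=> u0 [ns _]; apply: contrapT => nex.
have [||c cP] := @stabs_of_cut (pred1 i) u d u0; last 1 first.
- by apply: (ns c); apply: cP; rewrite /= eqxx.
- by exists i; rewrite /= eqxx.
move=> c cd; apply: contrapT => /not_orP[/existsNP[p /not_implyP[/eqP -> np]]].
by move=> /existsNP[q /not_implyP[/eqP -> nq]]; apply: nex; exists c.
Qed.

Lemma straddled_stabs i u c k : u != 0 -> straddled i u -> gap i u c ->
  k != i -> stabs (P k) u c.
Proof.
move=> u0 [_ sides] [nP nPN] ki; have [[x [y [xy uxy]]] ik_left] := sides k ki.
have uN0 : - u != 0 by rewrite oppr_eq0.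
have ik : i != k by rewrite eq_sym.
split; apply: contrapT => nPk.
  have [x' [y' [xy' uxy']]] := ik_left.
  by have := pair_stabber_turns_right ki u0 nPk nPN xy'; lra.
by have := pair_stabber_turns_right ik u0 nP nPk xy; lra.
Qed.

Lemma straddled_pair i p q u : straddled i u -> p != q ->
  left_pair p q u \/ p != i /\ q != i.
Proof.
move=> [_ sides] pq; have [ip|ip] := eqVneq p i.
  by left; have [] := sides q; rewrite -ip // eq_sym.
have [iq|iq] := eqVneq q i; last by right.
by left; have [] := sides p ip; rewrite iq.
Qed.

Lemma straddled_not_forces_right i u : u != 0 -> straddled i u ->
  ~ forces_right u.
Proof.
move=> u0 st [p [q [pq uP]]].
have [[x [y [xy uxy]]]|[pi qi]] := straddled_pair st (ltn_ord_neq pq).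
  by have := uP _ _ xy; lra.
have [c _ gap_c] := straddled_gap 0 u0 st.
have sp := straddled_stabs u0 st gap_c pi.
have sq := straddled_stabs u0 st gap_c qi.
have [x Cx xc] := stabs_meets_member sp.
have [y Cy yc] := stabs_meets_member sq.
have := uP _ _ (line_pair_stabber (ltn_ord_neq pq) u0 sp sq Cx Cy xc yc).
by rewrite crossBr xc yc subrr ltxx.
Qed.

Definition extreme u := exists p q, (p < q)%N /\
  forall x y, C p x -> C q y -> 0 <= cross u (y - x).

Lemma extreme_not_forces_right u : extreme u -> ~ forces_right u.
Proof.
move=> [i [j [ij vP]]] [p [q [pq uP]]].
have [x [y [x' [y' [k [xy [Cx Cy _ _] k0 kE]]]]]] :=
  parallel_pair_stabbers pq ij.
move: (uP _ _ xy) (vP _ _ Cx Cy); rewrite kE crossZr.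
by rewrite pmulr_rge0 //; lra.
Qed.

Lemma extreme_not_straddled i u : u != 0 -> extreme u -> ~ straddled i u.
Proof.
move=> u0 [p [q [pq uP]]] st; have qp : q != p by rewrite eq_sym ltn_ord_neq.
have [[y [x [[Cy Cx _ _] uyx]]]|[qi pi]] := straddled_pair st qp.
  by have := uP _ _ Cx Cy; rewrite -opprB crossNr; lra.
have [c _ gap_c] := straddled_gap 0 u0 st.
have [d dc gap_d] := straddled_gap c u0 st.
wlog cd : c d gap_c gap_d dc / c < d.
  move=> reduce; have [cd|dc_le] := ltrP c d; first exact: (reduce c d).
  by apply: (reduce d c) => //; [rewrite eq_sym|rewrite lt_neqAle dc].
have sp := straddled_stabs u0 st gap_d pi.
have sq := straddled_stabs u0 st gap_c qi.
have [x Cx xc] := stabs_meets_member sp.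
have [y Cy yc] := stabs_meets_member sq.
by have := uP _ _ Cx Cy; rewrite crossBr xc yc; lra.
Qed.

Lemma near_not_pair_stabber p q x y : p != q -> C p x -> C q y ->
  ~ pair_stabber p q x y ->
  \forall z \near (x, y), ~ pair_stabber p q z.1 z.2.
Proof.
move=> pq Cx Cy; have v0 := disjoint_neq (C_disjoint pq) Cx Cy.
have dz : z.2 - z.1 @[z --> (x, y)] --> y - x.
  by apply: cvgB; [exact: cvg_snd|exact: cvg_fst].
have bz : cross (z.2 - z.1) z.1 @[z --> (x, y)] --> cross (y - x) x.
  by apply: cvg_cross => //; exact: cvg_fst.
have near_not r : ~ stabs (P r) (y - x) (cross (y - x) x) ->
    \forall z \near (x, y), ~ stabs (P r) (z.2 - z.1) (cross (z.2 - z.1) z.1).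
  by move=> ns; apply: near_not_stabs dz bz ns => //; exact: P_closed.
move=> nps; have [sp|/near_not] :=
    pselect (stabs (P p) (y - x) (cross (y - x) x)); last first.
  by apply: filterS => z + [].
have [sq|/near_not] :=
    pselect (stabs (P q) (y - x) (cross (y - x) x)); last first.
  by apply: filterS => z + [].
by case: nps.
Qed.

Lemma near_forces_right (T : Type) (F : set_system T) {FF : Filter F}
    (U : T -> 'rV[R]_2) u : U @ F --> u -> forces_right u ->
  \forall t \near F, forces_right (U t).
Proof.
move=> Uu [p [q [pq uP]]].
suff : \forall t \near F, forall z : 'rV[R]_2 * 'rV[R]_2, (C p `*` C q) z ->
    pair_stabber p q z.1 z.2 -> cross (U t) (z.2 - z.1) < 0.
  apply: filterS => t tP; exists p, q; split => // x y xy.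
  by case: (xy) => Cx Cy _ _; apply: (tP (x, y)).
apply: compact_near; first exact: compact_setX.
move=> -[x y] [/= Cx Cy].
have [xy|nxy] := pselect (pair_stabber p q x y); last first.
  have near_not : \forall z \near filter_prod (nbhs (x, y)) F,
      ~ pair_stabber p q z.1.1 z.1.2.
    exact: cvg_fst (near_not_pair_stabber (ltn_ord_neq pq) Cx Cy nxy).
  by apply: filterS near_not => z nz xy; case: (nz xy).
have dz : z.2 - z.1 @[z --> (x, y)] --> y - x.
  by apply: cvgB; [exact: cvg_snd|exact: cvg_fst].
apply: filterS (near_cross_lt (cvg_comp_snd Uu) (cvg_comp_fst dz) (uP _ _ xy)).
by move=> z lt _.
Qed.

Lemma near_left_pair (T : Type) (F : set_system T) {FF : Filter F}
    (U : T -> 'rV[R]_2) u p q : U @ F --> u -> left_pair p q u ->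
  \forall t \near F, left_pair p q (U t).
Proof.
move=> Uu [x [y [xy uxy]]].
apply: filterS (near_cross_gt Uu (cvg_cst (y - x)) uxy) => t lt.
by exists x, y.
Qed.

Lemma near_straddled (T : Type) (F : set_system T) {FF : Filter F}
    (U : T -> 'rV[R]_2) i u : u != 0 -> U @ F --> u -> straddled i u ->
  \forall t \near F, straddled i (U t).
Proof.
move=> u0 Uu [ns sides].
have near_ns : \forall t \near F, forall x, C i x ->
    ~ stabs (P i) (U t) (cross (U t) x).
  apply: compact_near => // x Cx.
  have UF : U z.2 @[z --> filter_prod (nbhs x) F] --> u by exact: cvg_comp_snd.
  have xF : z.1 @[z --> filter_prod (nbhs x) F] --> x by exact: cvg_fst.
  by apply: near_not_stabs (cvg_cross UF xF) (ns _) => //; exact: P_closed.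
have near_sides : \forall t \near F, forall k, k != i ->
    left_pair i k (U t) /\ left_pair k i (U t).
  apply: filter_forall => k; have [->|ki] := eqVneq k i.
    by apply: nearW => t /eqP.
  have [ik_left ki_left] := sides k ki.
  apply: filterS2 (near_left_pair Uu ik_left) (near_left_pair Uu ki_left).
  by move=> t ikt kit _.
apply: filterS2 near_ns near_sides => t nst sides_t; split=> // c st.
have [x Cx xc] := stabs_meets_member st.
by apply: (nst x Cx); rewrite xc.
Qed.

Lemma ordered_on_extremes : exists u v,
  [/\ ordered_on C [set: 'I_n]%SET u, ordered_on C [set: 'I_n]%SET v,
      extreme u & extreme (- v)].
Proof.
pose I := {ij : 'I_n * 'I_n | (ij.1 < ij.2)%N}.
pose S (ij : I) := differences (C (val ij).1) (C (val ij).2).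
have commonP u : common S u <-> ordered_on C [set: 'I_n]%SET u.
  split=> [uS i j _ _ ij|uP [[i j] ij]]; first exact: (uS (exist _ (i, j) ij)).
  by apply: uP; rewrite ?inE.
have extremeP u : right_extreme S u -> extreme u.
  move=> [[[i j] ij] uS]; exists i, j; split=> // x y Cx Cy.
  by apply: uS; exists x => //; exists y.
pose I01 : I := exist _ (index0, index1) isT.
have [||||u [v [uS vS eu ev]]] := @common_extremes _ I S _ _ _ I01.
- by move=> ij; exact: compact_differences.
- by move=> ij; exact: convex_differences.
- by move=> -[[i j] ij]; apply/differences_not0/C_disjoint/ltn_ord_neq.
- have [||u uP] := pointed_cone_helly cone_pointed _ (A := [set: 'I_n]%SET).
  + by move=> A /four[u [c [_ _ uP]]]; exists u.
  + by rewrite cardsT card_ord.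
  by exists u; apply/commonP.
by exists u, v; split; [apply/commonP|apply/commonP|apply: extremeP..].
Qed.

Theorem closed_stabbed_in_order : stabbed_in_order C P [set: 'I_n]%SET.
Proof.
have [u [v [uP vP eu ev]]] := ordered_on_extremes.
pose U t := (1 - t) *: u + t *: v.
have U_ordered t : `[0, 1]%classic t -> ordered_on C [set: 'I_n]%SET (U t).
  rewrite /= in_itv /= => /andP[t0 t1] i j iA jA ij.
  have [_] := cone_pointed ij; apply; [exact: uP|exact: vP|lra|lra|lra].
have U0 t : `[0, 1]%classic t -> U t != 0.
  move=> /U_ordered/(_ index0 index1); rewrite !inE => /(_ isT isT isT).
  by apply: pointed_cone_neq0; exact: cone_pointed.
have Ucvg t : U s @[s --> t] --> U t.
  apply: cvgD; apply: cvgZr_tmp; last exact: cvg_id.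
  by apply: cvgB; [exact: cvg_cst|exact: cvg_id].
have NUcvg t : - U s @[s --> t] --> - U t by apply: cvgN; exact: Ucvg.
have [[t t01 [c tc]]|none] := pselect (exists2 t, `[0, 1]%classic t &
    exists c, forall i, stabs (P i) (U t) c).
  by exists (U t), c; split=> [|i _|]; [apply: U0| |apply: U_ordered].
have trichotomy t : `[0, 1]%classic t ->
    [\/ forces_right (U t), forces_right (- U t) | exists i, straddled i (U t)].
  move=> t01; apply: direction_trichotomy (U0 t t01) _ => tc.
  by apply: none; exists t.
have [U00 U11] : U 0 = u /\ U 1 = v.
  by rewrite /U subr0 subrr !scale0r !scale1r addr0 add0r.
have [I0 I1] : `[0, 1]%classic (0 : R) /\ `[0, 1]%classic (1 : R).
  by rewrite /= !in_itv /= !lexx ler01.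
exfalso; apply: (extreme_not_forces_right ev); rewrite -U11.
apply: (@connected_near_dichotomy _ _ (fun t => forces_right (- U t))
  (fun t => forces_right (U t) \/ exists i, straddled i (U t)) 0 1
  (@segment_connected R 0 1)) => //.
- by move=> t _ frN; exact: (near_forces_right (NUcvg t) frN).
- move=> t t01 [fr|[i st]].
    by apply: filterS (near_forces_right (Ucvg t) fr) => s; left.
  apply: filterS (near_straddled (U0 t t01) (Ucvg t) st) => s st_s.
  by right; exists i.
- by move=> t /trichotomy[]; tauto.
- move=> t t01 frN [/forces_rightN//|[i /straddledN st]].
  by apply: straddled_not_forces_right st frN; rewrite oppr_eq0 U0.
have := trichotomy 0 I0; rewrite U00 => -[fr|//|[i st]].
  by case: (extreme_not_forces_right eu fr).
by case: (extreme_not_straddled (i := i) _ eu st); rewrite -U00 U0.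
Qed.

End OrderedStabbing.

(** * Rotating a transversal about a point *)

Section Rotation.
Context {R : realType}.
Implicit Types (u v w x y z g : 'rV[R]_2) (b c d t : R) (A B C K : set 'rV[R]_2)
  (P Q : 'rV[R]_2 -> R -> Prop).

Lemma dir_cone_of_line A B v x y : pointed_cone (dir_cone A B) -> v != 0 ->
  A x -> B y -> cross v x = cross v y -> ~ dir_cone A B (- v) -> dir_cone A B v.
Proof.
move=> pAB v0 Ax By xy nN; have xyAB := dir_coneB Ax By.
have [|k kE] := @cross_eq0P _ v (y - x) v0; first by rewrite crossBr xy subrr.
have [k0|k0|k0] := ltrgtP k 0.
- case: nN; have -> : - v = (- k^-1) *: (y - x).
    by rewrite kE scaleNr scalerK // ltr0_neq0.
  by apply: pointed_coneZ; rewrite // oppr_gt0 invr_lt0.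
- rewrite -(scalerK (lt0r_neq0 k0) v) -kE.
  by apply: pointed_coneZ; rewrite // invr_gt0.
by case: pAB.1; rewrite k0 scale0r in kE; rewrite -kE.
Qed.

Lemma near_no_crossing (T : Type) (F : set_system T) {FF : Filter F} K
    (U : T -> 'rV[R]_2) u w z0 z : compact K -> ~ K z -> cross u w != 0 ->
  cross u z = cross u z0 -> U @ F --> u ->
  \forall t \near F, no_crossing K (U t) (cross (U t) z0) w (cross w z).
Proof.
move=> cK Kz uw uz Uu.
suff : \forall t \near F, forall q, K q ->
    cross (U t) (q - z0) != 0 \/ cross w q != cross w z.
  apply: filterS => t tP _ q Kq qz0 qz; have [] := tP q Kq.
    by rewrite crossBr qz0 subrr eqxx.
  by rewrite qz eqxx.
apply: compact_near => // q Kq.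
have qF : r.1 @[r --> filter_prod (nbhs q) F] --> q by exact: cvg_fst.
have UF : U r.2 @[r --> filter_prod (nbhs q) F] --> u by exact: cvg_comp_snd.
have qz0F : r.1 - z0 @[r --> filter_prod (nbhs q) F] --> q - z0.
  by apply: cvgB => //; exact: cvg_cst.
have [wq|wq] := eqVneq (cross w q) (cross w z); last first.
  by apply: filterS (near_cross_neq (cvg_cst w) qF wq) => r ?; right.
have [uq|uq] := eqVneq (cross u (q - z0)) 0; last first.
  by apply: filterS (near_cross_neq UF qz0F uq) => r ?; left.
case: Kz; suff <- : q = z by []; apply: (cross_inj uw) => //.
by rewrite uz; apply/eqP; rewrite -subr_eq0 -crossBr uq.
Qed.

(* As [0 < mu * nu], both lines reach [K] on the same side of [z0] and [z], so
   that the line rotated in the sense of [g] lies between them in [K]. *)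
Lemma near_rotated_stabs K P u w g z0 z mu nu : compact K -> side_rotates K P ->
  ~ K z0 -> ~ K z -> stabs P u (cross u z0) -> stabs P w (cross w z) ->
  K (z0 + mu *: u) -> K (z + nu *: w) -> cross u z = cross u z0 ->
  0 < mu * nu -> 0 < cross u w * cross u g ->
  \forall t \near 0^'+, stabs P (u + t *: g) (cross (u + t *: g) z0).
Proof.
move=> cK rK Kz0 Kz st_u st_w Kx Ky uz munu uwg.
pose U t := u + t *: g; have Ucvg : U t @[t --> 0^'+] --> u.
  by apply: cvg_turn; apply: cvg_at_right_filter; exact: cvg_id.
have [uw ug] : cross u w != 0 /\ cross u g != 0.
  by split; apply: contraTneq uwg => ->; rewrite ?mul0r ?mulr0 ltxx.
have u0 : u != 0 by apply: contraNneq uw => ->; rewrite cross0l.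
have w0 : w != 0 by apply: contraNneq uw => ->; rewrite cross0r.
have near_opposite : \forall t \near 0^'+,
    0 < cross (U t) ((mu * cross u g) *: (z + nu *: w - z0)).
  apply: (near_cross_gt Ucvg (cvg_cst _)).
  rewrite crossZr crossBr crossDr crossZr uz addrAC subrr add0r.
  have -> : mu * cross u g * (nu * cross u w) =
    (mu * nu) * (cross u w * cross u g) by ring.
  exact: mulr_gt0.
near=> t; have t0 : 0 < t by near: t; exact: nbhs_right_gt.
have Uu : cross (U t) u = - (t * cross u g).
  by rewrite crossDl crossvv crossZl add0r crossC mulrN.
have Uu0 : cross (U t) u != 0 by rewrite Uu oppr_eq0 mulf_neq0 // gt_eqF.
have U0 : U t != 0 by apply: contraNneq Uu0 => ->; rewrite cross0l.
apply: (stabs_rotate rK u0 U0 w0 st_u st_w Kx Ky).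
- by rewrite crossDr crossZr crossvv mulr0 addr0.
- by rewrite crossDr crossZr crossvv mulr0 addr0.
- have : 0 < cross (U t) ((mu * cross u g) *: (z + nu *: w - z0)) by near: t.
  rewrite crossZr -!crossBr [z0 + _]addrC addrK [cross _ (mu *: u)]crossZr Uu.
  nra.
- move=> _ q Kq qz0 qu; apply: Kz0; suff <- : q = z0 by [].
  exact: (cross_inj Uu0).
by near: t; exact: near_no_crossing Ucvg.
Unshelve. all: by end_near. Qed.

(* This is how closedness fails: the lines that meet [C] in [z] only are
   stabbers, but their limit, which contains [C], may not be one. *)
Definition pivot C P u c := exists z, [/\ C z, forall x, C x -> cross u x = c,
  forall v, cross u v != 0 -> stabs P v (cross v z)
  & forall v b, v != 0 -> stabs P v b -> cross u v != 0].

Definition relaxes C P Q := forall u c, u != 0 ->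
  (stabs P u c -> stabs Q u c) /\ (stabs Q u c -> stabs P u c \/ pivot C P u c).

End Rotation.

Section RelaxedStabbing.
Context {R : realType} (n : nat) (hn : (4 <= n)%N).
Variables (C : 'I_n -> set 'rV[R]_2) (P Q : 'I_n -> 'rV[R]_2 -> R -> Prop).
Hypotheses (C_disjoint : forall i j : 'I_n, i != j -> C i `&` C j = set0)
  (C_compact : forall i, compact (C i)) (C_convex : forall i, convex_set (C i))
  (P_meets : forall i, side_meets (C i) (P i))
  (P_rotates : forall i, side_rotates (C i) (P i))
  (four : forall A : {set 'I_n}, #|A| = 4 -> stabbed_in_order C P A).
Implicit Types (u v w x y z g : 'rV[R]_2) (c d t : R) (i j k m p : 'I_n).

Let cone_pointed := family_cone_pointed C_disjoint C_convex.

Let stabs_meets_member i u c (st : stabs (P i) u c) :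
  exists2 x, C i x & cross u x = c := stabs_meets (@C_convex i) (@P_meets i) st.

Lemma ordered_steps p k u w x y z0 z : p != k ->
  ordered_on C [set p; k]%SET u -> ordered_on C [set p; k]%SET w ->
  C p z0 -> C k x -> cross u z0 = cross u x ->
  C p z -> C k y -> cross w z = cross w y ->
  exists mu nu, [/\ 0 < mu * nu, x = z0 + mu *: u & y = z + nu *: w].
Proof.
move=> pk ord_u ord_w Cz0 Cx z0x Cz Cy zy.
have [pP kP] : p \in [set p; k]%SET /\ k \in [set p; k]%SET.
  by rewrite !inE !eqxx orbT.
have [lt_pk|lt_kp|/val_inj eq_pk] := ltngtP p k; last first.
- by rewrite eq_pk eqxx in pk.
- have [mu mu0 muE] := dir_cone_line (cone_pointed lt_kp)
    (ord_u _ _ kP pP lt_kp) Cx Cz0 (esym z0x).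
  have [nu nu0 nuE] := dir_cone_line (cone_pointed lt_kp)
    (ord_w _ _ kP pP lt_kp) Cy Cz (esym zy).
  by exists (- mu), (- nu); rewrite !scaleNr -muE -nuE !subKr mulrNN mulr_gt0.
have [mu mu0 muE] := dir_cone_line (cone_pointed lt_pk)
  (ord_u _ _ pP kP lt_pk) Cz0 Cx z0x.
have [nu nu0 nuE] := dir_cone_line (cone_pointed lt_pk)
  (ord_w _ _ pP kP lt_pk) Cz Cy zy.
by exists mu, nu; rewrite -muE -nuE !subrKC mulr_gt0.
Qed.

Lemma pivot_unique p k u c : pivot (C p) (P p) u c ->
  pivot (C k) (P k) u c -> p = k.
Proof.
move=> [z [_ pflat _ pcross]] [_ [_ kflat _ _]]; apply: contrapT => /eqP pk.
have [w [d [w0 st _]]] := stabbed_in_order_seq (s := [:: p; k]) hn isT four.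
have sp : stabs (P p) w d by apply: st; rewrite !inE eqxx.
have sk : stabs (P k) w d by apply: st; rewrite !inE eqxx orbT.
have [x Cx xd] := stabs_meets_member sp.
have [y Cy yd] := stabs_meets_member sk.
apply: (disjoint_notin (C_disjoint pk) Cx); suff -> : x = y by [].
by apply: (cross_inj (pcross _ _ w0 sp)); [rewrite pflat ?kflat|rewrite xd yd].
Qed.

(* Any two sets have a stabber in common with [C p], hence they turn in the
   same sense. *)
Lemma pivot_turn p u c : u != 0 -> pivot (C p) (P p) u c -> exists g,
  forall k, exists w d, [/\ stabs (P p) w d, stabs (P k) w d,
    ordered_on C [set p; k]%SET w & 0 < cross u w * cross u g].
Proof.
move=> u0 [z [_ _ _ pcross]]; have [g ug] := cross_eq1 u0.
pose turns k g := exists w d, [/\ stabs (P p) w d, stabs (P k) w d,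
  ordered_on C [set p; k]%SET w & 0 < cross u w * cross u g].
have [all_g|/existsNP[m not_g]] := pselect (forall k, turns k g).
  by exists g.
exists (- g) => k; have [w [d [w0 st ord]]] :=
  stabbed_in_order_seq (s := [:: p; k; m]) hn isT four.
have sp : stabs (P p) w d by apply: st; rewrite !inE eqxx.
have ord_pair j : j \in [:: k; m] -> ordered_on C [set p; j]%SET w.
  rewrite !inE => jkm; apply: ordered_onS ord; apply/fintype.subsetP => a.
  by rewrite !inE => /orP[|] /eqP ->; rewrite ?eqxx // jkm orbT.
exists w, d; split=> //.
- by apply: st; rewrite !inE eqxx orbT.
- by apply: ord_pair; rewrite !inE eqxx ?orbT.
rewrite crossNr ug mulrN1 oppr_gt0 lt_neqAle (pcross _ _ w0 sp) leNgt.
apply/negP => uw; apply: not_g; exists w, d; split=> //.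
- by apply: st; rewrite !inE eqxx !orbT.
- by apply: ord_pair; rewrite !inE eqxx ?orbT.
by rewrite ug mulr1.
Qed.

Lemma near_not_opposite (F : set_system R) {FF : Filter F} (U : R -> 'rV[R]_2)
    i j u : (i < j)%N -> u != 0 -> dir_cone (C i) (C j) u -> U @ F --> u ->
  \forall t \near F, ~ dir_cone (C i) (C j) (- U t).
Proof.
move=> ij u0 uij Uu; have NUcvg : - U t @[t --> F] --> - u by apply: cvgN.
apply: near_not_dir_cone (C_disjoint (ltn_ord_neq ij)) _ NUcvg _ => //.
  by rewrite oppr_eq0.
rewrite -scaleN1r => /(pointed_cone_scale_gt0 (cone_pointed ij) uij).
by rewrite oppr_gt0 ltr10.
Qed.

Lemma near_pivot_stabs p k u w c d g z0 : p != k -> C p z0 ->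
  (forall x, C p x -> cross u x = c) -> ordered_on C [set p; k]%SET u ->
  ordered_on C [set p; k]%SET w -> stabs (P k) u c -> stabs (P p) w d ->
  stabs (P k) w d -> 0 < cross u w * cross u g ->
  \forall t \near 0^'+, stabs (P k) (u + t *: g) (cross (u + t *: g) z0).
Proof.
move=> pk Cz0 flat ord_u ord_w st_u sp sk uwg.
have [x Cx xc] := stabs_meets_member st_u.
have [y Cy yd] := stabs_meets_member sk.
have [z Cz zd] := stabs_meets_member sp.
have [||mu [nu [munu xE yE]]] := ordered_steps (x := x) (y := y) (z := z)
  pk ord_u ord_w Cz0 Cx _ Cz Cy.
- by rewrite xc flat.
- by rewrite yd.
have Ck q : C p q -> ~ C k q by exact: (disjoint_notin (C_disjoint pk)).
apply: (near_rotated_stabs (@C_compact k) (@P_rotates k) (Ck z0 Cz0) (Ck z Cz)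
  _ _ _ _ _ munu uwg).
- by rewrite flat.
- by rewrite zd.
- by rewrite -xE.
- by rewrite -yE.
by rewrite !flat.
Qed.

Lemma rotate_pivot p u c : u != 0 -> pivot (C p) (P p) u c ->
  (forall k, k != p -> stabs (P k) u c) -> ordered_on C [set: 'I_n]%SET u ->
  stabbed_in_order C P [set: 'I_n]%SET.
Proof.
move=> u0 piv st ord; have [g turn] := pivot_turn u0 piv.
have [z0 [Cz0 flat through _]] := piv; pose U t := u + t *: g.
have Ucvg : U t @[t --> 0^'+] --> u.
  by apply: cvg_turn; apply: cvg_at_right_filter; exact: cvg_id.
have near_st : \forall t \near 0^'+, forall k, k != p ->
    stabs (P k) (U t) (cross (U t) z0).
  apply: filter_forall => k; have [->|kp] := eqVneq k p.
    by apply: nearW => t /eqP.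
  have [w [d [sp sk ord_w uwg]]] := turn k.
  have pk : p != k by rewrite eq_sym.
  have ord_u : ordered_on C [set p; k]%SET u.
    by apply: ordered_onS ord; exact: finset.subsetT.
  have near_k := near_pivot_stabs pk Cz0 flat ord_u ord_w (st k kp) sp sk uwg.
  by apply: filterS near_k => t st_t _.
have near_ord : \forall t \near 0^'+, forall ij : 'I_n * 'I_n,
    (ij.1 < ij.2)%N -> ~ dir_cone (C ij.1) (C ij.2) (- U t).
  apply: filter_forall => -[i j] /=.
  have [ij|ij] := boolP (i < j)%N; last exact: nearW.
  have uij : dir_cone (C i) (C j) u by apply: ord; rewrite ?inE.
  by apply: filterS (near_not_opposite ij u0 uij Ucvg) => t nN _.
have [t [[t0 st_t] ord_t]] := filter_ex
  (filterI (filterI (nbhs_right_gt 0) near_st) near_ord).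
have uU0 : cross u (U t) != 0.
  have [w [d [_ _ _ uwg]]] := turn p.
  rewrite crossDr crossvv add0r crossZr mulf_neq0 //; first by rewrite gt_eqF.
  by apply: contraTneq uwg => ->; rewrite mulr0 ltxx.
have Ut0 : U t != 0 by apply: contraNneq uU0 => ->; rewrite cross0r.
have st_all k : stabs (P k) (U t) (cross (U t) z0).
  by have [->|] := eqVneq k p; [exact: through|exact: st_t].
exists (U t), (cross (U t) z0); split=> // i j _ _ ij.
have [x Cx xc] := stabs_meets_member (st_all i).
have [y Cy yc] := stabs_meets_member (st_all j).
apply: (dir_cone_of_line (cone_pointed ij) Ut0 Cx Cy); first by rewrite xc yc.
exact: (ord_t (i, j)).
Qed.

Hypotheses (Q_meets : forall i, side_meets (C i) (Q i))
  (Q_rotates : forall i, side_rotates (C i) (Q i))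
  (Q_closed : forall i, side_closed (C i) (Q i))
  (PQ_relaxes : forall i, relaxes (C i) (P i) (Q i)).

Theorem relaxed_stabbed_in_order : stabbed_in_order C P [set: 'I_n]%SET.
Proof.
have fourQ (A : {set 'I_n}) : #|A| = 4 -> stabbed_in_order C Q A.
  move=> /four[u [c [u0 st ord]]]; exists u, c; split=> // i iA.
  by have [PQ _] := PQ_relaxes i c u0; exact/PQ/st.
have [u [c [u0 stQ ord]]] := closed_stabbed_in_order hn C_disjoint C_compact
  C_convex Q_meets Q_rotates fourQ Q_closed.
have {}stQ i : stabs (P i) u c \/ pivot (C i) (P i) u c.
  by have [_] := PQ_relaxes i c u0; apply; apply: stQ; rewrite inE.
have [st|/existsNP[p nst]] := pselect (forall i, stabs (P i) u c).
  by exists u, c.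
have [//|piv] := stQ p; apply: (rotate_pivot u0 piv _ ord) => k kp.
have [//|pivk] := stQ k.
by rewrite (pivot_unique piv pivk) eqxx in kp.
Qed.

End RelaxedStabbing.

(** * Slices and the Hausdorff distance *)

Section Slices.
Context {R : realType}.
Implicit Types (u v w x y z : 'rV[R]_2) (a b c d e s t : R)
  (A B C K : set 'rV[R]_2) (f : set 'rV[R]_2 -> R).

Lemma euclid_norm0 : euclid_norm 0 = 0 :> R.
Proof. by rewrite /euclid_norm !mxE expr0n /= addr0 sqrtr0. Qed.

Lemma euclid_normN x : euclid_norm (- x) = euclid_norm x.
Proof. by rewrite /euclid_norm !mxE !sqrrN. Qed.

Lemma near_euclid_norm_lt (T : Type) (F : set_system T) {FF : Filter F}
    (g : T -> 'rV[R]_2) x y e : g @ F --> x -> euclid_norm (x - y) < e ->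
  \forall t \near F, euclid_norm (g t - y) < e.
Proof.
move=> gx; have gxy : g t - y @[t --> F] --> x - y.
  by apply: cvgB => //; exact: cvg_cst.
have coord j : (g t - y) 0 j @[t --> F] --> (x - y) 0 j.
  by apply: (cvg_comp _ (fun x => x 0 j) gxy); exact: coord_continuous.
have sqr j : (g t - y) 0 j ^+ 2 @[t --> F] --> (x - y) 0 j ^+ 2.
  exact: (cvgM (coord j) (coord j)).
have norm_cvg : euclid_norm (g t - y) @[t --> F] --> euclid_norm (x - y).
  exact: (cvg_comp _ _ (cvgD (sqr 0) (sqr 1)) (@sqrt_continuous R _)).
exact: (cvgr_lt _ norm_cvg).
Qed.

Lemma hausdorff_dist_lt A B e d : 0 <= e -> e < d ->
  (forall x, A x -> exists2 y, B y & euclid_norm (x - y) <= e) ->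
  (forall y, B y -> exists2 x, A x & euclid_norm (x - y) <= e) ->
  (hausdorff_dist A B < d%:E)%E.
Proof.
move=> e0 ed AB BA; apply: (@le_lt_trans _ _ e%:E); last by rewrite lte_fin.
rewrite /hausdorff_dist !ge_max lee_fin e0 /=; apply/andP; split.
  apply: ge_ereal_sup => _ [x /AB[y By xy] <-]; apply: ge_ereal_inf.
  by exists (euclid_norm (x - y))%:E; [exists y|rewrite lee_fin].
apply: ge_ereal_sup => _ [y /BA[x Ax xy] <-]; apply: ge_ereal_inf.
by exists (euclid_norm (x - y))%:E; [exists x|rewrite lee_fin].
Qed.

Lemma hausdorff_dist_subset_lt A B d : 0 < d -> A `<=` B ->
  (forall y, B y -> exists2 x, A x & euclid_norm (y - x) < d / 2) ->
  (hausdorff_dist A B < d%:E)%E /\ (hausdorff_dist B A < d%:E)%E.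
Proof.
move=> d0 AB BA.
have near_self x K : K x -> exists2 y, K y & euclid_norm (x - y) <= d / 2.
  by move=> Kx; exists x => //; rewrite subrr euclid_norm0; lra.
split; apply: (@hausdorff_dist_lt _ _ (d / 2)); try lra.
- by move=> x /AB/near_self.
- move=> y /BA[x Ax yx]; exists x => //.
  by rewrite -euclid_normN opprB ltW.
- by move=> y /BA[x Ax yx]; exists x => //; exact: ltW.
move=> x /AB Bx; exists x => //; rewrite subrr euclid_norm0; lra.
Qed.

Definition slice C u c : set 'rV[R]_2 := C `&` [set x | cross u x <= c].

Lemma slice_convex C u c : convex_set C -> convex_set (slice C u c).
Proof.
move=> /convex_setP cC; apply/convex_setP => x y s [Cx /= xc] [Cy /= yc] s0 s1.
by split; [exact: cC|rewrite /= !crossE; nra].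
Qed.

Lemma slice_subset C u c : slice C u c `<=` C.
Proof. by move=> x []. Qed.

Lemma sliceS C u v c b : (forall x, C x -> cross u x <= c -> cross v x <= b) ->
  slice C u c `<=` slice C v b.
Proof. by move=> uv x [Cx /= xc]; split=> //=; exact: uv. Qed.

Lemma slice_full C u c : (forall x, C x -> cross u x <= c) -> slice C u c = C.
Proof.
by move=> uc; apply/seteqP; split=> [x []//|x Cx]; split=> //=; exact: uc.
Qed.

Lemma slice_nonempty_limit C u c : compact C ->
  (forall e, 0 < e -> slice C u (c + e) !=set0) -> slice C u c !=set0.
Proof.
move=> cC ne; have [z [Cz _]] := ne 1 ltr01.
have [x Cx xm] := compact_cross_min u cC (ex_intro _ z Cz).
exists x; split=> //=; apply/ler_addgt0Pr => e /ne[y [Cy /= yc]].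
by rewrite (le_trans (xm y Cy)).
Qed.

Lemma near_slice_outer C u c e : compact C -> 0 < e ->
  \forall t \near c, forall x, C x -> cross u x <= t ->
    exists2 y, slice C u c y & euclid_norm (x - y) < e.
Proof.
move=> cC e0; apply: (@compact_near _ _ (nbhs c)) => // x Cx.
have xF : z.1 @[z --> (x, c)] --> x by exact: cvg_fst.
have [xc|cx] := lerP (cross u x) c.
  have xx : euclid_norm (x - x) < e by rewrite subrr euclid_norm0.
  by apply: filterS (near_euclid_norm_lt xF xx) => z lt _; exists x.
have slack : z.2 - cross u z.1 @[z --> (x, c)] --> c - cross u x.
  by apply: cvgB; [exact: cvg_snd|exact: cvg_cross (cvg_cst u) xF].
have : c - cross u x < 0 by rewrite subr_lt0.
by move=> /(cvgr_lt _ slack); apply: filterS => z; rewrite subr_lt0 leNgt => ->.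
Qed.

Lemma near_slice_inner C u c w e : compact C -> convex_set C -> C w ->
  cross u w < c -> 0 < e ->
  \forall t \near c, forall x, C x -> cross u x <= c ->
    exists2 y, slice C u t y & euclid_norm (x - y) < e.
Proof.
move=> cC /convex_setP vC Cw wc e0.
apply: (@compact_near _ _ (nbhs c)) => // x Cx.
have xF : z.1 @[z --> (x, c)] --> x by exact: cvg_fst.
have [xc|cx] := lerP (cross u x) c; last first.
  apply: filterS (near_cross_gt (cvg_cst u) xF cx) => z lt.
  by rewrite leNgt lt.
have : \forall s \near 0^'+, euclid_norm (x + s *: (w - x) - x) < e.
  apply: (near_euclid_norm_lt (x := x)); last by rewrite subrr euclid_norm0.
  by apply: cvg_turn; apply: cvg_at_right_filter; exact: cvg_id.
move=> /(filterI (filterI (nbhs_right_gt 0) (nbhs_right_le ltr01)))/filter_ex.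
move=> [s [[s0 s1]]]; set y := x + s *: (w - x) => yx.
have yE : y = s *: w + (1 - s) *: x.
  by rewrite /y scalerBr scalerBl scale1r addrCA.
have Cy : C y by rewrite yE; apply: vC => //; exact: ltW.
have yc : cross u y < c by rewrite yE !crossE; nra.
have xy : euclid_norm (x - y) < e by rewrite -euclid_normN opprB.
have cF : z.2 @[z --> (x, c)] --> c by exact: cvg_snd.
apply: filterS2 (near_euclid_norm_lt xF xy) (cvgr_gt _ cF _ yc) => z zy yz _.
by exists y => //; split=> //=; exact: ltW.
Qed.

Lemma hausdorff_cvg (T : Type) (F : set_system T) {FF : Filter F} f K
    (K_ : T -> set 'rV[R]_2) :
  hausdorff_continuous f -> convex_set K -> (forall i, convex_set (K_ i)) ->
  (forall d, 0 < d -> \forall i \near F, (hausdorff_dist K (K_ i) < d%:E)%E) ->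
  f (K_ i) @[i --> F] --> f K.
Proof.
move=> fc vK vK_ near_K; apply/cvgrPdist_lt => e e0.
have [d d0 dP] := fc _ vK e e0.
by apply: filterS (near_K d d0) => i; exact: dP.
Qed.

Lemma cvg_slice_right C u c f : compact C -> convex_set C ->
  hausdorff_continuous f -> f (slice C u t) @[t --> c^'+] --> f (slice C u c).
Proof.
move=> cC vC fc; apply: hausdorff_cvg => // [|t|d d0]; try exact: slice_convex.
have d2 : 0 < d / 2 by rewrite divr_gt0.
rewrite near_withinE; apply: filterS (near_slice_outer u c cC d2) => t tP ct.
apply: (hausdorff_dist_subset_lt d0 _ _).1 => [|y [Cy /= yt]]; last exact: tP.
by apply: sliceS => x _ /le_trans; apply; exact: ltW.
Qed.

Lemma cvg_slice_left C u c w f : compact C -> convex_set C ->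
  hausdorff_continuous f -> C w -> cross u w < c ->
  f (slice C u t) @[t --> c^'-] --> f (slice C u c).
Proof.
move=> cC vC fc Cw wc.
apply: hausdorff_cvg => // [|t|d d0]; try exact: slice_convex.
have d2 : 0 < d / 2 by rewrite divr_gt0.
rewrite near_withinE.
apply: filterS (near_slice_inner cC vC Cw wc d2) => t tP tc.
apply: (hausdorff_dist_subset_lt d0 _ _).2 => [|y [Cy /= yt]]; last exact: tP.
by apply: sliceS => x _ /le_trans; apply; exact: ltW.
Qed.

Lemma slice_ge_right C u c f a : compact C -> convex_set C ->
  hausdorff_continuous f -> (forall t, c < t -> a <= f (slice C u t)) ->
  a <= f (slice C u c).
Proof.
move=> cC vC fc af; have fcvg := cvg_slice_right (u := u) (c := c) cC vC fc.
rewrite -(cvg_lim (@Rhausdorff R) fcvg); apply: limr_ge; first exact: cvgP fcvg.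
by apply: filterS (nbhs_right_gt c) => t /af.
Qed.

Lemma slice_ge_left C u c w f a : compact C -> convex_set C ->
  hausdorff_continuous f -> C w -> cross u w < c ->
  (forall t, t < c -> a <= f (slice C u t)) -> a <= f (slice C u c).
Proof.
move=> cC vC fc Cw wc af; have fcvg := cvg_slice_left cC vC fc Cw wc.
rewrite -(cvg_lim (@Rhausdorff R) fcvg); apply: limr_ge; first exact: cvgP fcvg.
by apply: filterS (nbhs_left_lt c) => t /af.
Qed.

End Slices.

(** * Side conditions of monotone continuous functions *)

Section MonotoneSides.
Context {R : realType}.
Implicit Types (u v w x y z : 'rV[R]_2) (a b c e s t : R)
  (C Z K : set 'rV[R]_2) (P Q : 'rV[R]_2 -> R -> Prop)
  (f : set 'rV[R]_2 -> R).

Definition slice_stabs C f a u c := [/\ slice C u c !=set0,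
  slice C (- u) (- c) !=set0, a <= f (slice C u c)
  & a <= f (slice C (- u) (- c))].

Definition increasing_side C f a u c :=
  slice C u c !=set0 /\ a <= f (slice C u c).

Definition decreasing_side C f a u c :=
  slice C u c !=set0 /\ a <= f (slice C (- u) (- c)).

Definition convex_increasing f := forall K1 K2 : set 'rV[R]_2,
  convex_set K1 -> convex_set K2 -> K1 `<=` K2 -> f K1 <= f K2.

Definition convex_decreasing f := forall K1 K2 : set 'rV[R]_2,
  convex_set K1 -> convex_set K2 -> K1 `<=` K2 -> f K2 <= f K1.

Lemma slice_stabsN C f a u c : slice_stabs C f a u c ->
  slice_stabs C f a (- u) (- c).
Proof. by case=> *; split; rewrite ?opprK. Qed.

Lemma stabs_increasing_side C f a u c :
  stabs (increasing_side C f a) u c <-> slice_stabs C f a u c.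
Proof. by split=> [[[? ?] [? ?]]|[? ? ? ?]]; split. Qed.

Lemma stabs_decreasing_side C f a u c :
  stabs (decreasing_side C f a) u c <-> slice_stabs C f a u c.
Proof.
rewrite /stabs /decreasing_side !opprK.
by split=> [[[? ?] [? ?]]|[? ? ? ?]]; split.
Qed.

Lemma increasing_side_meets C f a : side_meets C (increasing_side C f a).
Proof. by move=> u c [[x [Cx xc]] _]; exists x. Qed.

Lemma decreasing_side_meets C f a : side_meets C (decreasing_side C f a).
Proof. by move=> u c [[x [Cx xc]] _]; exists x. Qed.

Lemma no_crossing_lt C u c v b x z : convex_set C -> C x -> C z ->
  cross v x = b -> cross v z = b -> cross u x <= c -> no_crossing C u c v b ->
  cross u v != 0 -> cross u z < c.
Proof.
move=> vC Cx Cz xb zb xc nc uv; rewrite ltNge; apply/negP => cz.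
have [s [_ _ Cs sc]] := convex_cross_ivt vC Cx Cz xc cz.
by apply: (nc uv _ Cs sc); rewrite !crossE xb zb; ring.
Qed.

Lemma no_crossing_le C u c v b x z : convex_set C -> v != 0 -> C x -> C z ->
  cross v x = b -> cross v z = b -> cross u x <= c -> no_crossing C u c v b ->
  cross u z <= c.
Proof.
move=> vC v0 Cx Cz xb zb xc nc; have [uv|uv] := eqVneq (cross u v) 0.
  have [|k kE] := @cross_eq0P _ v u v0; first by rewrite crossC uv oppr0.
  by move: xc; rewrite kE !crossZl xb zb.
by apply/ltW/(no_crossing_lt vC Cx Cz xb zb xc nc uv).
Qed.

Lemma not_subset_slice C K u c : K `<=` C -> ~ K `<=` slice C u c ->
  exists2 x, K x & c < cross u x.
Proof.
move=> KC /existsNP[x /not_implyP[Kx nx]]; exists x => //.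
by rewrite ltNge; apply/negP => xc; apply: nx; split=> //; exact: KC.
Qed.

Lemma increasing_side_rotates C f a : convex_set C -> convex_increasing f ->
  side_rotates C (increasing_side C f a).
Proof.
move=> vC fm u c v b x u0 v0 /stabs_increasing_side[_ _ a1 a2] Cx xb xc nc.
split; first by exists x.
suff [sub|sub] : slice C v b `<=` slice C u c \/
    slice C (- v) (- b) `<=` slice C u c.
- by apply: le_trans a1 _; apply: fm => //; exact: slice_convex.
- by apply: le_trans a2 _; apply: fm => //; exact: slice_convex.
apply: contrapT => /not_orP[].
move=> /(not_subset_slice (@slice_subset R _ _ _))[y [Cy /= yb] cy].
move=> /(not_subset_slice (@slice_subset R _ _ _))[y' [Cy' /=]].
rewrite crossNl lerN2 => yb' cy'.
have [s [s0 s1 Cs sb]] := convex_cross_ivt vC Cy Cy' yb yb'.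
have := no_crossing_le vC v0 Cx Cs xb sb xc nc.
apply/negP; rewrite -ltNge !crossE.
have [cm my my'] : [/\ c < Num.min (cross u y) (cross u y'),
    Num.min (cross u y) (cross u y') <= cross u y &
    Num.min (cross u y) (cross u y') <= cross u y'].
  by rewrite lt_min cy cy' !ge_min !lexx ?orbT.
by apply: (lt_le_trans cm); nra.
Qed.

Lemma decreasing_side_rotates C f a : convex_set C -> convex_decreasing f ->
  side_rotates C (decreasing_side C f a).
Proof.
move=> vC fm u c v b x u0 v0 /stabs_decreasing_side[_ _ a1 a2] Cx xb xc nc.
split; first by exists x.
suff [sub|sub] : slice C (- u) (- c) `<=` slice C v b \/
    slice C (- u) (- c) `<=` slice C (- v) (- b).
- by apply: le_trans a1 _; apply: fm => //; exact: slice_convex.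
- by apply: le_trans a2 _; apply: fm => //; exact: slice_convex.
apply: contrapT => /not_orP[].
move=> /(not_subset_slice (@slice_subset R _ _ _))[y [Cy /=] +].
rewrite crossNl lerN2 => cy yb.
move=> /(not_subset_slice (@slice_subset R _ _ _))[y' [Cy' /=]].
rewrite !crossNl lerN2 ltrN2 => cy' yb'.
have [s [s0 s1 Cs sb]] := convex_cross_ivt vC Cy' Cy (ltW yb') (ltW yb).
have cs : c <= cross u (s *: y' + (1 - s) *: y) by rewrite !crossE; nra.
have [uv|uv] := eqVneq (cross u v) 0; last first.
  by have := no_crossing_lt vC Cx Cs xb sb xc nc uv; rewrite ltNge cs.
have [|k kE] := @cross_eq0P _ v u v0; first by rewrite crossC uv oppr0.
have k0 : k != 0 by apply: contraNneq u0 => k0; rewrite kE k0 scale0r.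
move: xc cy cy'; rewrite kE !crossZl xb => xc cy cy'.
by move: k0; rewrite neq_lt => /orP[k0|k0]; nra.
Qed.

Lemma side_limit_slice_neq0 C P u c : compact C -> side_meets C P ->
  side_limit C P u c -> slice C u c !=set0.
Proof.
move=> cC mC lim; apply: slice_nonempty_limit => // e.
move=> /lim[v [b [/mC[x Cx xb] near_uc]]].
exists x; split=> //=.
by have := near_uc x Cx; rewrite ler_norml => /andP[]; lra.
Qed.

Lemma side_limit_sliceS C P u c t : side_limit C P u c -> c < t ->
  exists v b, P v b /\ slice C v b `<=` slice C u t.
Proof.
move=> lim ct; have [|v [b [vb near_uc]]] := lim (t - c).
  by rewrite subr_gt0.
exists v, b; split=> //; apply: sliceS => x /near_uc.
by rewrite ler_norml => /andP[]; lra.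
Qed.

Lemma side_limit_supsliceS C P u c t : side_limit C P u c -> t < - c ->
  exists v b, P v b /\ slice C (- u) t `<=` slice C (- v) (- b).
Proof.
move=> lim tc; have [|v [b [vb near_uc]]] := lim (- c - t).
  by rewrite subr_gt0.
exists v, b; split=> //; apply: sliceS => x /near_uc.
by rewrite !crossNl ler_norml => /andP[]; lra.
Qed.

Lemma increasing_side_closed C f a : compact C -> convex_set C ->
  hausdorff_continuous f -> convex_increasing f ->
  side_closed C (increasing_side C f a).
Proof.
move=> cC vC fc fm u c u0 lim limN.
suff limit_in w d : side_limit C (increasing_side C f a) w d ->
    increasing_side C f a w d by split; exact: limit_in.
move=> {limN}lim; split.
  by apply: side_limit_slice_neq0 lim => //; exact: increasing_side_meets.
apply: slice_ge_right => // t /(side_limit_sliceS lim)[v [b [[_ ab] sub]]].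
by apply: le_trans ab _; apply: fm => //; exact: slice_convex.
Qed.

Lemma decreasing_side_limit C f a u c : compact C -> convex_set C ->
  hausdorff_continuous f -> convex_decreasing f ->
  ((forall x, C x -> cross u x = c) -> a <= f C) ->
  side_limit C (decreasing_side C f a) u c ->
  side_limit C (decreasing_side C f a) (- u) (- c) ->
  decreasing_side C f a u c.
Proof.
move=> cC vC fc fm flat lim limN; split.
  by apply: side_limit_slice_neq0 lim => //; exact: decreasing_side_meets.
have ge_below w d t : side_limit C (decreasing_side C f a) w d -> t < - d ->
    a <= f (slice C (- w) t).
  move=> lim_wd /(side_limit_supsliceS lim_wd)[v [b [[_ ab] sub]]].
  by apply: le_trans ab _; apply: fm => //; exact: slice_convex.
have [[w [Cw wc]]|nw] := pselect (exists w, C w /\ cross (- u) w < - c).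
  by apply: slice_ge_left Cw wc _ => // t; exact: ge_below.
have le_c x : C x -> cross u x <= c.
  move=> Cx; rewrite leNgt; apply/negP => lt; apply: nw.
  by exists x; rewrite crossNl ltrN2.
suff aC : a <= f C.
  by apply: le_trans aC _; apply: fm => //;
    [exact: slice_convex|exact: slice_subset].
have [[w [Cw wc]]|nw'] := pselect (exists w, C w /\ cross u w < c).
  rewrite -(slice_full le_c); apply: slice_ge_left Cw wc _ => // t tc.
  by rewrite -[u]opprK; apply: ge_below limN _; rewrite opprK.
apply: flat => x Cx; apply/eqP; rewrite eq_le le_c //= leNgt; apply/negP => lt.
by apply: nw'; exists x.
Qed.

Lemma decreasing_side_closed_at C f a u c : compact C -> convex_set C ->
  hausdorff_continuous f -> convex_decreasing f ->
  ((forall x, C x -> cross u x = c) -> a <= f C) ->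
  side_closed_at C (decreasing_side C f a) u c.
Proof.
move=> cC vC fc fm flat lim limN.
split; apply: decreasing_side_limit => //; last by rewrite !opprK.
by move=> flatN; apply: flat => x /flatN; rewrite crossNl => /oppr_inj.
Qed.

Definition side_of Z u c := exists2 z, Z z & cross u z <= c.

Lemma stabs_side_of Z u c : convex_set Z -> stabs (side_of Z) u c ->
  exists2 z, Z z & cross u z = c.
Proof. by move=> vZ; apply: stabs_meets vZ _ => v b [z Zz zb]; exists z. Qed.

Lemma side_of_meets C Z : Z `<=` C -> side_meets C (side_of Z).
Proof. by move=> ZC u c [z Zz zc]; exists z => //; exact: ZC. Qed.

Lemma side_of_rotates C Z : convex_set C -> convex_set Z -> Z `<=` C ->
  side_rotates C (side_of Z).
Proof.
move=> vC vZ ZC u c v b x u0 v0 /(stabs_side_of vZ)[z Zz zb] Cx xb xc nc.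
exists z => //; exact: no_crossing_le vC v0 Cx (ZC z Zz) xb zb xc nc.
Qed.

Lemma side_of_closed C Z : compact Z -> Z `<=` C -> side_closed C (side_of Z).
Proof.
move=> cZ ZC u c u0 lim limN.
suff limit_in w d : side_limit C (side_of Z) w d -> side_of Z w d.
  by split; exact: limit_in.
move=> {limN}lim.
have [|z [Zz /= zd]] := @slice_nonempty_limit _ Z w d cZ; last by exists z.
move=> e /lim[v [b [[z Zz zb] near_wd]]]; exists z; split=> //=.
by have := near_wd z (ZC _ Zz); rewrite ler_norml => /andP[]; lra.
Qed.

Section FlatSet.
Variables (C : set 'rV[R]_2) (f : set 'rV[R]_2 -> R) (a : R) (d : 'rV[R]_2).
Hypotheses (C_compact : compact C) (C_convex : convex_set C)
  (f_continuous : hausdorff_continuous f) (f_decreasing : convex_decreasing f)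
  (d_neq0 : d != 0) (C_flat : forall x y, C x -> C y -> cross d x = cross d y)
  (f_lt : f C < a).

(* The points about which the stabbers of [C] can be rotated freely, short of
   containing [C]. *)
Definition flat_core : set 'rV[R]_2 := [set z | C z /\
  forall w, cross w d != 0 -> slice_stabs C f a w (cross w z)].

Lemma flat_cross_eq u x y : C x -> C y -> cross u d = 0 ->
  cross u x = cross u y.
Proof.
move=> Cx Cy ud; have [|k ->] := @cross_eq0P _ d u d_neq0.
  by rewrite crossC ud oppr0.
by rewrite !crossZl (C_flat Cx Cy).
Qed.

Lemma flat_slice v w z : C z -> 0 < cross v d * cross w d ->
  slice C v (cross v z) = slice C w (cross w z).
Proof.
suff sub v' w' : C z -> 0 < cross v' d * cross w' d ->
    slice C v' (cross v' z) `<=` slice C w' (cross w' z).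
  by move=> Cz vw; apply/seteqP; split; apply: sub; rewrite // mulrC.
move=> Cz vw; apply: sliceS => x Cx.
have [|k xE] := @cross_eq0P _ d (x - z) d_neq0.
  by rewrite crossBr (C_flat Cx Cz) subrr.
by rewrite -(subrK z x) xE !crossDr !gerDr !crossZr; nra.
Qed.

Lemma flat_stabs_transfer v w z : C z -> cross v d != 0 -> cross w d != 0 ->
  slice_stabs C f a v (cross v z) -> slice_stabs C f a w (cross w z).
Proof.
move=> Cz vd wd; wlog vw : v vd / 0 < cross v d * cross w d.
  move=> reduce; have : cross v d * cross w d != 0 by rewrite mulf_neq0.
  rewrite neq_lt => /orP[vw|]; last exact: reduce.
  move/slice_stabsN; rewrite -crossNl.
  apply: reduce; first by rewrite crossNl oppr_eq0.
  by rewrite crossNl mulNr oppr_gt0.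
have vwN : 0 < cross (- v) d * cross (- w) d by rewrite !crossNl mulrNN.
by rewrite /slice_stabs -!crossNl (flat_slice Cz vw) (flat_slice Cz vwN).
Qed.

Lemma flat_stabs_cross_neq0 u c : slice_stabs C f a u c -> u != 0 ->
  cross u d != 0.
Proof.
move=> st u0; apply/eqP => ud.
have [x Cx xc] := stabs_meets C_convex (@decreasing_side_meets C f a)
  ((stabs_decreasing_side C f a u c).2 st).
case: st => _ _ + _; rewrite slice_full => [|y Cy]; first by rewrite leNgt f_lt.
by rewrite (flat_cross_eq Cy Cx ud) xc.
Qed.

Lemma flat_core_convex : convex_set flat_core.
Proof.
apply/convex_setP => z1 z2 s [C1 st1] [C2 st2] s0 s1.
have Cz : C (s *: z1 + (1 - s) *: z2) by have /convex_setP := C_convex; apply.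
have ge_conv w : a <= f (slice C w (cross w z1)) ->
    a <= f (slice C w (cross w z2)) ->
    a <= f (slice C w (cross w (s *: z1 + (1 - s) *: z2))).
  rewrite crossDr !crossZr => a1 a2.
  have [z12|/ltW z21] := lerP (cross w z1) (cross w z2).
    apply: le_trans a2 _; apply: f_decreasing; [exact: slice_convex..|].
    by apply: sliceS => x _ /le_trans; apply; nra.
  apply: le_trans a1 _; apply: f_decreasing; [exact: slice_convex..|].
  by apply: sliceS => x _ /le_trans; apply; nra.
split=> // w wd; have [_ _ a1 b1] := st1 w wd; have [_ _ a2 b2] := st2 w wd.
rewrite /slice_stabs -!crossNl in b1 b2 *.
split; [by exists (s *: z1 + (1 - s) *: z2); split=> /=..|exact: ge_conv|].
exact: ge_conv.
Qed.

Lemma flat_core_compact : compact flat_core.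
Proof.
apply: (subclosed_compact _ C_compact) => [x core_x|z []//].
have Cx : C x.
  apply: (compact_closed (@norm_hausdorff _ _) C_compact).
  by apply: closureS core_x => z [].
split=> // w wd; apply/stabs_decreasing_side; apply: contrapT => nst.
have f_ge : (forall y, C y -> cross w y = cross w x) -> a <= f C.
  move=> flat_w; have [z [[Cz /(_ w wd)[_ _ + _]] _]] := core_x _ filterT.
  by rewrite slice_full // => y Cy; rewrite !flat_w.
have closed_w : side_closed_at C (decreasing_side C f a) w (cross w x).
  exact: decreasing_side_closed_at.
have near_nst : \forall z \near x,
    ~ stabs (decreasing_side C f a) w (cross w z).
  apply: (@near_not_stabs _ _ (nbhs x) _ _ _ (fun=> w)) closed_w _ _ nst => //.
    exact: (cvg_cst w).
  exact: cross_continuous.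
have [z [[_ /(_ w wd) st_z]]] := core_x _ near_nst.
by apply; exact/stabs_decreasing_side.
Qed.

Lemma flat_core_relaxes :
  relaxes C (decreasing_side C f a) (side_of flat_core).
Proof.
move=> u c u0; split=> [st|/(stabs_side_of flat_core_convex)[z [Cz core_z] zc]].
  have [x Cx xc] := stabs_meets C_convex (@decreasing_side_meets C f a) st.
  move/stabs_decreasing_side in st; have ud := flat_stabs_cross_neq0 st u0.
  have core_x : flat_core x.
    by split=> // w wd; apply: flat_stabs_transfer ud wd _; rewrite ?xc.
  by split; exists x; rewrite ?crossNl ?xc.
have [ud|ud] := eqVneq (cross u d) 0; last first.
  by left; apply/stabs_decreasing_side; rewrite -zc; exact: core_z.
right; exists z; split=> // [x Cx|v uv|v b v0 /stabs_decreasing_side st].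
- by rewrite (flat_cross_eq Cx Cz ud).
- apply/stabs_decreasing_side/core_z; apply: contraNneq uv => vd.
  have [|k ->] := @cross_eq0P _ d v d_neq0; first by rewrite crossC vd oppr0.
  by rewrite crossZr ud mulr0.
apply: contraNneq (flat_stabs_cross_neq0 st v0) => uv.
by have [k ->] := cross_eq0P u0 uv; rewrite crossZl ud mulr0.
Qed.

End FlatSet.

(* A relaxation is needed only if [f] is decreasing, [C] lies on a line and
   [f C < a], in which case the stabbers are the lines other than that one
   through the points of a segment of [C]. *)
Theorem relaxed_side_conditions C f a : compact C -> convex_set C ->
  hausdorff_continuous f -> convex_monotone f -> exists P Q,
  [/\ [/\ side_meets C P, side_rotates C P
         & forall u c, stabs P u c <-> slice_stabs C f a u c],
      [/\ side_meets C Q, side_rotates C Q & side_closed C Q]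
    & relaxes C P Q].
Proof.
move=> cC vC fc [fm|fm].
  exists (increasing_side C f a), (increasing_side C f a).
  have rotates := increasing_side_rotates (a := a) vC fm.
  have meets := @increasing_side_meets C f a.
  have closed := increasing_side_closed (a := a) cC vC fc fm.
  by split; [split=> //; exact: stabs_increasing_side| |split=> //; left].
have rotates := decreasing_side_rotates (a := a) vC fm.
have meets := @decreasing_side_meets C f a.
exists (decreasing_side C f a).
have [[d [d0 flat fCa]]|nflat] := pselect (exists d : 'rV[R]_2, [/\ d != 0,
    forall x y, C x -> C y -> cross d x = cross d y & f C < a]).
  have core_sub : flat_core C f a d `<=` C by move=> z [].
  have core_convex := @flat_core_convex C f a d vC fm.
  have core_compact := @flat_core_compact C f a d cC vC fc fm.
  exists (side_of (flat_core C f a d)).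
  split; [split=> //; exact: stabs_decreasing_side| |exact: flat_core_relaxes].
  by split; [exact: side_of_meets|exact: side_of_rotates|exact: side_of_closed].
exists (decreasing_side C f a).
split; [split=> //; exact: stabs_decreasing_side|split=> //|by split; [|left]].
move=> u c u0; apply: decreasing_side_closed_at => // flat_u.
rewrite leNgt; apply/negP => fCa; apply: nflat; exists u.
by split=> // x y Cx Cy; rewrite !flat_u.
Qed.

End MonotoneSides.

(** * Directed lines *)

Lemma increasing_enumeration (n m : nat) (A : {set 'I_n}) : #|A| = m ->
  exists2 s : 'I_m -> 'I_n, {mono s : a b / (a < b)%N} &
    forall i, i \in A -> exists a, s a = i.
Proof.
move=> <-; exists (@Order.enum_val _ 'I_n A) => [|i iA].
  by apply: leW_mono; apply: Order.le_enum_val; exact: le_total.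
by exists (Order.enum_rank_in iA i); rewrite Order.enum_rankK_in.
Qed.

Section DirectedLines.
Context {R : realType}.
Implicit Types (C : set 'rV[R]_2) (l : directed_line R) (u : 'rV[R]_2).

Definition dl_offset l : R := cross (dl_dir l) (dl_base l).

Lemma right_part_slice l C : right_part l C = slice C (dl_dir l) (dl_offset l).
Proof.
by apply/seteqP; split=> x [Cx /= h]; split=> //=; move: h;
  rewrite crossBr subr_le0.
Qed.

Lemma left_part_slice l C :
  left_part l C = slice C (- dl_dir l) (- dl_offset l).
Proof.
by apply/seteqP; split=> x [Cx /= h]; split=> //=; move: h;
  rewrite crossBr crossNl subr_ge0 lerN2.
Qed.

Lemma fa_stabber_slice_stabs f (a : R) C l t : C (dl_point l t) ->
  fa_stabber f a C l <-> slice_stabs C f a (dl_dir l) (dl_offset l).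
Proof.
move=> Ct; have on_line : cross (dl_dir l) (dl_point l t) = dl_offset l.
  by rewrite crossDr crossZr crossvv mulr0 addr0.
rewrite /fa_stabber left_part_slice right_part_slice.
split=> [[a1 a2]|[_ _ a1 a2]]; split=> //; exists (dl_point l t); split=> //=.
  by rewrite on_line.
by rewrite crossNl on_line.
Qed.

Lemma slice_stabs_meets C f (a : R) u c : convex_set C ->
  slice_stabs C f a u c -> exists2 x, C x & cross u x = c.
Proof.
move=> vC /stabs_increasing_side.
exact: stabs_meets vC (@increasing_side_meets _ C f a).
Qed.

Lemma dl_point_dir_cone l A B (s t : R) :
  A (dl_point l s) -> B (dl_point l t) -> s < t -> dir_cone A B (dl_dir l).
Proof.
move=> As Bt st; have ts0 : t - s != 0 by rewrite subr_eq0 gt_eqF.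
exists (dl_point l t - dl_point l s), (t - s)^-1; split.
- by exists (dl_point l s) => //; exists (dl_point l t).
- by rewrite invr_gt0 subr_gt0.
by rewrite /dl_point opprD addrACA subrr add0r -scalerBl scalerK.
Qed.

Lemma exists_directed_line u c : u != 0 ->
  exists l, dl_dir l = u /\ dl_offset l = c.
Proof.
move=> u0; have [w uw] := cross_eq1 u0.
by exists (DirectedLine (c *: w) u0); rewrite /dl_offset /= crossZr uw mulr1.
Qed.

Lemma dl_pointP l x : cross (dl_dir l) x = dl_offset l ->
  exists t, x = dl_point l t.
Proof.
move=> xl; have [|t tE] := @cross_eq0P _ _ (x - dl_base l) (dl_dir_neq0 l).
  by rewrite crossBr xl subrr.
by exists t; rewrite /dl_point -tE addrC subrK.
Qed.

Section Transversals.
Variables (n : nat) (C : 'I_n -> set 'rV[R]_2) (f : 'I_n -> set 'rV[R]_2 -> R)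
  (alpha : 'I_n -> R) (P : 'I_n -> 'rV[R]_2 -> R -> Prop).
Hypotheses (C_disjoint : forall i j : 'I_n, i != j -> C i `&` C j = set0)
  (C_convex : forall i, convex_set (C i))
  (stabsP : forall i u c,
    stabs (P i) u c <-> slice_stabs (C i) (f i) (alpha i) u c).

Lemma transversal_stabbed_in_order (m : nat) (s : 'I_m -> 'I_n)
    (A : {set 'I_n}) l :
  {mono s : a b / (a < b)%N} -> (forall i, i \in A -> exists a, s a = i) ->
  fa_transversal (fun a => f (s a)) (fun a => alpha (s a))
    (fun a => C (s a)) l ->
  meets_in_order (fun a => C (s a)) l -> stabbed_in_order C P A.
Proof.
move=> s_mono sA trl [t [tC t_mono]].
exists (dl_dir l), (dl_offset l); split; first exact: dl_dir_neq0.
  by move=> i /sA[a <-]; apply/stabsP/(fa_stabber_slice_stabs _ _ (tC a)).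
move=> _ _ /sA[a <-] /sA[b <-]; rewrite s_mono => ab.
exact: dl_point_dir_cone (tC a) (tC b) (t_mono _ _ ab).
Qed.

Lemma stabbed_in_order_transversal : stabbed_in_order C P [set: 'I_n]%SET ->
  exists l, fa_transversal f alpha C l /\ meets_in_order C l.
Proof.
move=> [u [c [u0 st ord]]]; have [l [lu lc]] := exists_directed_line c u0.
have {}st i : slice_stabs (C i) (f i) (alpha i) (dl_dir l) (dl_offset l).
  by rewrite lu lc; apply/stabsP/st; rewrite inE.
have /choice[t tC] i : exists t, C i (dl_point l t).
  have [x Cx /dl_pointP[t xE]] := slice_stabs_meets (@C_convex i) (st i).
  by exists t; rewrite -xE.
exists l; split=> [i|]; first exact/(fa_stabber_slice_stabs _ _ (tC i)).
exists t; split=> // i j ij.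
have cone_ij := family_cone_pointed C_disjoint C_convex ij.
have := ord i j; rewrite !inE -lu => /(_ isT isT ij) lij.
rewrite -subr_gt0; apply: (pointed_cone_scale_gt0 cone_ij lij).
have -> : (t j - t i) *: dl_dir l = dl_point l (t j) - dl_point l (t i).
  by rewrite /dl_point opprD addrACA subrr add0r scalerBl.
exact: dir_coneB.
Qed.

End Transversals.

End DirectedLines.

Theorem theorem3p2 (R : realType) (n : nat) (hn : (4 <= n)%N)
    (C : 'I_n -> set 'rV[R]_2)
    (C_disjoint : forall i j : 'I_n, i != j -> C i `&` C j = set0)
    (C_compact : forall i : 'I_n, compact (C i))
    (C_convex : forall i : 'I_n, convex_set (C i))
    (f : 'I_n -> set 'rV[R]_2 -> R)
    (f_monotone : forall i : 'I_n, convex_monotone (f i))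
    (f_continuous : forall i : 'I_n, hausdorff_continuous (f i))
    (alpha : 'I_n -> R)
    (alpha_gt0 : forall i : 'I_n, 0 < alpha i)
    (four : forall s : 'I_4 -> 'I_n,
      (forall a b : 'I_4, (a < b)%N -> (s a < s b)%N) ->
      exists l : directed_line R,
        fa_transversal (fun j => f (s j)) (fun j => alpha (s j))
                       (fun j => C (s j)) l /\
        meets_in_order (fun j => C (s j)) l) :
  exists l : directed_line R, fa_transversal f alpha C l /\ meets_in_order C l.
Proof.
have /choice[P /choice[Q PQ]] i := relaxed_side_conditions (alpha i)
  (C_compact i) (C_convex i) (f_continuous i) (f_monotone i).
have P_meets i : side_meets (C i) (P i) by have [[]] := PQ i.
have P_rotates i : side_rotates (C i) (P i) by have [[]] := PQ i.
have stabsP i u c : stabs (P i) u c <-> slice_stabs (C i) (f i) (alpha i) u c.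
  by have [[]] := PQ i.
have Q_meets i : side_meets (C i) (Q i) by have [_ []] := PQ i.
have Q_rotates i : side_rotates (C i) (Q i) by have [_ []] := PQ i.
have Q_closed i : side_closed (C i) (Q i) by have [_ []] := PQ i.
have P_relaxes i : relaxes (C i) (P i) (Q i) by have [] := PQ i.
apply: (stabbed_in_order_transversal C_disjoint C_convex stabsP).
apply: (relaxed_stabbed_in_order hn C_disjoint C_compact C_convex P_meets
  P_rotates _ Q_meets Q_rotates Q_closed P_relaxes) => A A4.
have [s s_mono sA] := increasing_enumeration A4.
have [a b ab|l [trl ordl]] := four s; first by rewrite s_mono.
exact: (transversal_stabbed_in_order stabsP s_mono sA trl ordl).
Qed.
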